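(* Let $q$ be a prime power and $m>4$ an integer. Let $k=\binom{m}{2}$, $n=\left[{m\atop 2}\right]_q$, $\delta=2(m-2)$ and $\mu=m-1$. Then the Grassmann code $C(2,m)$ satisfies $$d_{k-\mu-1}(C(2,m))=n-(1+q+\cdots+q^{\mu-1}+q^2)$$ and $$d_{\mu+1}(C(2,m))=q^{\delta}+q^{\delta-1}+2q^{\delta-2}+q^{\delta-3}+\cdots+q^{\delta-\mu+1},$$ i.e. $d_{\mu+1}(C(2,m))=\sum_{j=0}^{\mu-1}q^{\delta-j}+q^{\delta-2}$.
   Context: For a linear code $C\subseteq\mathbb F_q^n$ and $D\subseteq \mathbb F_q^n$, $\mathrm{supp}(D)=\{i: x_i\neq 0\text{ for some }x\in D\}$ and $\|D\|=|\mathrm{supp}(D)|$; the $r$-th higher weight is $d_r(C)=\min\{\|D\|: D\text{ a subspace of }C,\ \dim D=r\}$. The Gaussian binomial coefficient is $\left[{m\atop \ell}\right]_q=\prod_{i=0}^{\ell-1}\frac{q^m-q^i}{q^\ell-q^i}$. Grassmann code: let $V=\mathbb F_q^m$ with fixed basis $e_1,\dots,e_m$, identify $\bigwedge^mV$ with $\mathbb F_q$ via $e_1\wedge\cdots\wedge e_m=1$. Let $\omega'_1,\dots,\omega'_n\in\bigwedge^{\ell}V$ be fixed representatives (nonzero decomposable vectors $v_1\wedge\cdots\wedge v_\ell$), one for each $\ell$-dimensional subspace of $V$ (so $n=\left[{m\atop \ell}\right]_q$). The map $\tau:\bigwedge^{m-\ell}V\to\mathbb F_q^n$, $\tau(\omega)=(\omega'_1\wedge\omega,\dots,\omega'_n\wedge\omega)$,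 is injective and $C(\ell,m)$ is its image, an $[n,\binom{m}{\ell}]_q$ linear code. Here $\ell=2$. *)

(* Defs.v *)
From HB Require Import structures.
From mathcomp Require Import all_boot all_order all_algebra.
Set Implicit Arguments. Unset Strict Implicit. Unset Printing Implicit Defensive.
Import GRing.Theory.
Local Open Scope ring_scope.

(* r-element subsets of {0,..,m-1}: index set of the standard basis
   e_A = e_{a1} /\ ... /\ e_{ar} (a1 < ... < ar) of /\^r V, V = F^m. *)
Notation rsets m r := {A : {set 'I_m} | #|A| == r} (only parsing).

(* /\^r V, as coordinate vectors w.r.t. the basis (e_A)_A. *)
Definition wedge (F : finFieldType) (m r : nat) := {ffun rsets m r -> F}.

(* u /\ v in /\^2 V : coordinate at A = {i<j} is u_i v_j - u_j v_i. *)
Definition wedge2 (F : finFieldType) (m : nat) (u v : 'rV[F]_m) : wedge F m 2 :=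
  [ffun A : rsets m 2 =>
     \sum_(i in val A) \sum_(j in val A | (i < j)%N) (u 0 i * v 0 j - u 0 j * v 0 i)].

(* sign of e_A /\ e_B = sgn * e_1 /\ ... /\ e_m for disjoint A, B:
   (-1)^(number of pairs (a,b) in A x B with b < a). *)
Definition wsign (m : nat) (A B : {set 'I_m}) (F : finFieldType) : F :=
  (-1) ^+ #|[set p : 'I_m * 'I_m | (p.1 \in A) && (p.2 \in B) && (p.2 < p.1)%N]|.

(* The pairing /\^2 V x /\^(m-2) V -> /\^m V = F (e_1/\.../\e_m = 1). *)
Definition wedge_top (F : finFieldType) (m : nat)
    (a : wedge F m 2) (b : wedge F m (m - 2)%N) : F :=
  \sum_(A : rsets m 2) \sum_(B : rsets m (m - 2)%N | [disjoint val A & val B])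
     wsign (val A) (val B) F * a A * b B.

Definition span2 (F : finFieldType) (m : nat) (u v : 'rV[F]_m) : {set 'rV[F]_m} :=
  [set x : 'rV[F]_m | (x <= col_mx u v)%MS].

Definition is_plane (F : finFieldType) (m : nat) (S : {set 'rV[F]_m}) : bool :=
  [exists u : 'rV[F]_m, exists v : 'rV[F]_m,
     (\rank (col_mx u v) == 2%N) && (S == span2 u v)].

Notation Gr2 F m := {S : {set 'rV[F]_m} | is_plane S} (only parsing).

Definition good_reps (F : finFieldType) (m : nat) (rep : Gr2 F m -> wedge F m 2) :=
  forall S : Gr2 F m, exists u v : 'rV[F]_m,
    \rank (col_mx u v) = 2%N /\ val S = span2 u v /\ rep S = wedge2 u v.

Definition tau (F : finFieldType) (m : nat) (rep : Gr2 F m -> wedge F m 2)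
    (w : wedge F m (m - 2)%N) : 'rV[F]_#|{: Gr2 F m}| :=
  \row_(j < #|{: Gr2 F m}|) wedge_top (rep (enum_val j)) w.

Definition grassmann_code (F : finFieldType) (m : nat) (rep : Gr2 F m -> wedge F m 2)
    : 'M[F]_#|{: Gr2 F m}| :=
  (\sum_(w : wedge F m (m - 2)%N) <<tau rep w>>)%MS.

(* support of the subspace spanned by the rows of D *)
Definition msupp (F : fieldType) (r n : nat) (D : 'M[F]_(r, n)) : {set 'I_n} :=
  [set j : 'I_n | col j D != 0].

Definition is_higher_weight (F : fieldType) (n : nat) (C : 'M[F]_n) (r d : nat) : Prop :=
  (exists D : 'M[F]_(r, n), [/\ \rank D = r, (D <= C)%MS & #|msupp D| = d])
  /\ (forall D : 'M[F]_(r, n), \rank D = r -> (D <= C)%MS -> (d <= #|msupp D|)%N).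

Definition gauss_binom (q m l : nat) : rat :=
  \prod_(i < l) ((q ^ m - q ^ i)%:R / (q ^ l - q ^ i)%:R).

(* Main.v *)
Require Import Defs.
From HB Require Import structures.
From mathcomp Require Import all_boot all_order all_algebra.
From mathcomp Require Import mxabelem zify ring.
Import GRing.Theory.
Local Open Scope ring_scope.

(* Codewords are evaluations of alternating forms on planes, so a subcode of
   dimension r is a space of alternating matrices of dimension r, and the
   coordinates outside its support are the points of the Grassmannian lying on
   the annihilator, a subspace A of /\^2 V of dimension k - r.  Everything rests
   on a bound for subspaces A of dimension m = mu + 1: A contains at most
   q^(m-1) + q^3 - q^2 decomposable vectors (zero included).  To prove it, fix
   x <> 0, let H = A :&: (x /\ V) have dimension s, and split A into cosets of H.
   If a /\ b is decomposable and outside x /\ V, then a /\ b + x /\ y is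
   decomposable only for y in <x, a, b>, so a nonzero coset contains at most q^2
   decomposable vectors.  Choosing some x with s >= 3 this gives
   q^s + q^2 (q^(m-s) - 1), which is convex in s and attains the bound at s = 3
   and s = m - 1.  If s = 2, a coset with more than q decomposable vectors forces
   H = x /\ <a, b> and lies on a fixed line of A / H; if s <= 1 for all x, each
   nonzero coset contains at most one.  Equality holds for
   A = x /\ V + <a /\ b>.

   For r = k - m the bound counts the zero coordinates directly.  For r = m it is
   applied to the space of forms itself: summing the weights of all forms counts
   each support element q^m - q^(m-1) times, decomposable forms have rank 2, all
   others rank at least 4, and the weight increases with the rank. *)

Set Implicit Arguments.
Unset Strict Implicit.
Unset Printing Implicit Defensive.

(** * Plücker coordinates and alternating matrices *)

Section PluckerCoordinates.

Variables (F : finFieldType) (m : nat).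

Notation N := #|{: rsets m 2}|.

Implicit Types (u v x y a b : 'rV[F]_m) (c : 'rV[F]_N).

Definition pairset (k : 'I_N) : {set 'I_m} := val (enum_val k).

Lemma pairsetP k : exists i j : 'I_m, (i < j)%N /\ pairset k = [set i; j].
Proof.
have /cards2P [i [j [ij ->]]] : #|pairset k| == 2 := valP (enum_val k).
have [lt_ij|lt_ji|/val_inj eq_ij] := ltngtP i j.
- by exists i, j.
- by exists j, i; rewrite setUC.
- by rewrite eq_ij eqxx in ij.
Qed.

Lemma ex_pairset (i j : 'I_m) : i != j -> exists k, pairset k = [set i; j].
Proof.
move=> ij; have card_ij : #|[set i; j]| == 2 by rewrite cards2 ij.
by exists (enum_rank (exist _ [set i; j] card_ij)); rewrite /pairset enum_rankK.
Qed.

Lemma pairset_inj : injective pairset.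
Proof. by move=> k l /val_inj/enum_val_inj. Qed.

Lemma mem_pairset (i j : 'I_m) k : i != j ->
  (i \in pairset k) && (j \in pairset k) = (pairset k == [set i; j]).
Proof.
move=> ij; rewrite eq_sym eqEcard cards2 ij (eqP (valP (enum_val k))) /=.
by rewrite subUset !sub1set andbT.
Qed.

(** Numbering the coordinates by ['I_N] turns subspaces of [/\^2 V] into row spaces, so that the
    rank calculus of matrices applies to them. *)
Definition pluecker u v : 'rV[F]_N := \row_k wedge2 u v (enum_val k).

Lemma plueckerE u v k (i j : 'I_m) : (i < j)%N -> pairset k = [set i; j] ->
  pluecker u v 0 k = u 0 i * v 0 j - u 0 j * v 0 i.
Proof.
move=> ij kij; have nij : i != j by rewrite neq_ltn ij.
rewrite mxE ffunE -/(pairset k) kij big_setU1 ?inE //= big_set1.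
rewrite (eq_bigl (pred1 j)) ?big_pred1_eq => [|l]; last first.
  apply/andP/eqP => [[/set2P[]-> //]|->]; first by rewrite ltnn.
  by rewrite !inE eqxx orbT.
rewrite big1 ?addr0 // => l; rewrite !inE.
by case/andP=> /orP[] /eqP ->; rewrite ?ltnn // ltnNge ltnW.
Qed.

(* The alternating matrix whose entries above the diagonal are the coordinates
   of [c]; [sgn] makes the definition uniform in [i] and [j]. *)
Definition sgn (i j : 'I_m) : F := (i < j)%:R - (j < i)%:R.

Definition alt c : 'M[F]_m :=
  \matrix_(i, j) (sgn i j *
    \sum_(k | (i \in pairset k) && (j \in pairset k)) c 0 k).

Lemma altE c k (i j : 'I_m) : (i < j)%N -> pairset k = [set i; j] ->
  alt c i j = c 0 k.
Proof.
move=> ij kij; have nij : i != j by rewrite neq_ltn ij.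
rewrite mxE /sgn ij ltnNge ltnW //= subr0 mul1r (big_pred1 k) // => l.
by rewrite mem_pairset // -kij (inj_eq pairset_inj).
Qed.

Lemma alt_diag c i : alt c i i = 0.
Proof. by rewrite mxE /sgn subrr mul0r. Qed.

Lemma alt_anti c i j : alt c j i = - alt c i j.
Proof.
rewrite !mxE /sgn -mulNr opprB; congr (_ * _).
by apply: eq_bigl => k; rewrite andbC.
Qed.

Lemma alt_is_linear : linear alt.
Proof.
move=> t c d; apply/matrixP=> i j; rewrite !mxE.
rewrite mulrCA -mulrDr; congr (_ * _); rewrite mulr_sumr -big_split /=.
by under eq_bigr => k _ do rewrite !mxE.
Qed.

HB.instance Definition _ :=
  GRing.isLinear.Build F 'rV[F]_N 'M[F]_m *:%R alt alt_is_linear.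

Lemma alt_inj : injective alt.
Proof.
move=> c d eq_cd; apply/rowP=> k; have [i [j [ij kij]]] := pairsetP k.
by rewrite -(altE c ij kij) -(altE d ij kij) eq_cd.
Qed.

Lemma alt_pluecker u v : alt (pluecker u v) = u^T *m v - v^T *m u.
Proof.
have lt_case (i j : 'I_m) : (i < j)%N ->
    alt (pluecker u v) i j = u 0 i * v 0 j - u 0 j * v 0 i.
  move=> ij; have [|k kij] := @ex_pairset i j; first by rewrite neq_ltn ij.
  by rewrite (altE _ ij kij) (plueckerE _ _ ij kij).
apply/matrixP=> i j; have -> : (u^T *m v - v^T *m u) i j =
    u 0 i * v 0 j - u 0 j * v 0 i.
  by rewrite !mxE !big_ord1 !mxE [v 0 i * _]mulrC.
have [ij|ji|/val_inj ->] := ltngtP i j.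
- by rewrite lt_case.
- by rewrite alt_anti lt_case // opprB.
- by rewrite alt_diag mulrC subrr.
Qed.

(** This links codewords to forms: a linear functional on [/\^2 V] evaluated at [u /\ v] is the
    value at [(u, v)] of an alternating form. *)
Lemma form_alt u v c : u *m alt c *m v^T = c *m (pluecker u v)^T.
Proof.
apply/rowP=> l; rewrite {l}ord1 !mxE.
have -> : \sum_j (u *m alt c) 0 j * v^T j 0 =
    \sum_k c 0 k * \sum_(i in pairset k) \sum_(j in pairset k)
      sgn i j * (u 0 i * v 0 j).
  under eq_bigr => j _ do rewrite !mxE mulr_suml.
  rewrite exchange_big /=.
  under eq_bigr => i _ do under eq_bigr => j _ do
    rewrite mxE mulrA mulrAC mulr_sumr big_mkcond.
  under [RHS]eq_bigr => k _ do rewrite mulr_sumr big_mkcond.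
  rewrite [RHS]exchange_big; apply: eq_bigr => i _.
  rewrite exchange_big; apply: eq_bigr => k _.
  case: (i \in _) => /=; last by rewrite big1.
  rewrite mulr_sumr [RHS]big_mkcond; apply: eq_bigr => j _.
  by case: ifP => // _; ring.
apply: eq_bigr => k _; rewrite mxE; congr (_ * _).
have [i [j [ij kij]]] := pairsetP k; rewrite (plueckerE _ _ ij kij) kij.
have nij : i \notin [set j] by rewrite inE neq_ltn ij.
rewrite !big_setU1 //= !big_set1 !big_setU1 //= !big_set1.
by rewrite /sgn !ltnn ij ltnNge ltnW //=; ring.
Qed.

Lemma pluecker_is_linear u : linear (pluecker u).
Proof.
move=> t v w; apply: alt_inj; rewrite linearP /= !alt_pluecker.
rewrite mulmxDr -scalemxAr linearP mulmxDl -scalemxAl /=.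
by rewrite scalerBr opprD addrACA.
Qed.

HB.instance Definition _ u :=
  GRing.isLinear.Build F 'rV[F]_m 'rV[F]_N *:%R (pluecker u)
    (pluecker_is_linear u).

Lemma plueckerC u v : pluecker u v = - pluecker v u.
Proof. by apply: alt_inj; rewrite linearN /= !alt_pluecker opprB. Qed.

Lemma plueckerxx u : pluecker u u = 0.
Proof. by apply: alt_inj; rewrite alt_pluecker subrr linear0. Qed.

Lemma plueckerDl u v w : pluecker (u + v) w = pluecker u w + pluecker v w.
Proof. by rewrite plueckerC linearD opprD /= -!plueckerC. Qed.

Lemma plueckerZl t u w : pluecker (t *: u) w = t *: pluecker u w.
Proof. by rewrite plueckerC linearZ -scalerN /= -plueckerC. Qed.

Lemma plueckerZr t u w : pluecker u (t *: w) = t *: pluecker u w.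
Proof. exact: linearZ. Qed.

(** The matrix factors as [Z^T *m J *m Z] with [J] the invertible standard symplectic matrix and [Z]
    of full row rank. *)
Lemma rank_alt_hyperbolic p (Z1 Z2 : 'M[F]_(p, m)) :
  row_free (col_mx Z1 Z2) -> \rank (Z1^T *m Z2 - Z2^T *m Z1) = (p + p)%N.
Proof.
move=> freeZ; set Z := col_mx Z1 Z2 in freeZ.
pose J : 'M[F]_(p + p) := block_mx 0 1%:M (- 1%:M) 0.
have -> : Z1^T *m Z2 - Z2^T *m Z1 = Z^T *m J *m Z.
  rewrite tr_col_mx mul_row_block !mulmx0 addr0 add0r mulmx1 mulmxN mulmx1.
  by rewrite mul_row_col mulNmx addrC.
have Junit : J \in unitmx.
  have /mulmx1_unit[] // : J *m (- J) = 1%:M.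
  rewrite opp_block_mx mulmx_block !oppr0 opprK !mulmx0 !mul0mx !mulmx1.
  by rewrite !addr0 !add0r mulmxN mulmx1 opprK -scalar_mx_block.
rewrite mxrankMfree // mxrankMfree ?row_free_unit //.
by rewrite mxrank_tr (eqP freeZ).
Qed.

End PluckerCoordinates.

(** * Row spaces: independence, sums over a subspace, splitting into cosets *)

Section RowSpaces.

Variables (F : finFieldType) (n : nat).
Implicit Types u v w y : 'rV[F]_n.

Lemma row_free_rV u : row_free u = (u != 0).
Proof. by rewrite /row_free rank_rV; case: (u == 0). Qed.

Lemma rank_addsmx_row p y (A : 'M[F]_(p, n)) :
  ~~ (y <= A)%MS -> \rank (y + A)%MS = (\rank A).+1.
Proof.
move=> yA; have y0 : y != 0 by apply: contraNneq yA => ->; rewrite sub0mx.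
rewrite mxrank_disjoint_sum ?rank_rV ?y0 //.
apply/eqP; rewrite -mxrank_eq0 -leqn0 -ltnS; move: yA; apply: contraR.
rewrite -leqNgt => rk; apply: submx_trans (capmxSr y A).
by rewrite -(geq_leqif (mxrank_leqif_sup (capmxSl _ _))) rank_rV y0.
Qed.

Lemma row_free_cons p y (A : 'M[F]_(p, n)) :
  row_free A -> ~~ (y <= A)%MS -> row_free (col_mx y A).
Proof.
by move=> freeA yA; apply/eqP; rewrite -addsmxE rank_addsmx_row // (eqP freeA).
Qed.

Lemma row_free_col_rV u v :
  row_free (col_mx u v) = (v != 0) && ~~ (u <= v)%MS.
Proof.
apply/idP/andP=> [free_uv|[v0 uv]]; last by rewrite row_free_cons ?row_free_rV.
have rk : \rank (u + v)%MS = 2%N by rewrite addsmxE (eqP free_uv).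
split; apply/negP.
  move/eqP=> v0; move: rk; rewrite v0 addsmx0 rank_rV; by case: (u != 0).
by move=> /addsmx_idPr uv; move: rk; rewrite uv rank_rV; case: (v != 0).
Qed.

Lemma sub_col_rVP w u v :
  reflect (exists s t, w = s *: u + t *: v) (w <= col_mx u v)%MS.
Proof.
apply: (iffP submxP) => [[D ->]|[s [t ->]]].
  rewrite -[D]hsubmxK mul_row_col; exists (lsubmx D 0 0), (rsubmx D 0 0).
  by rewrite -!mul_scalar_mx -!mx11_scalar.
exists (row_mx s%:M t%:M); by rewrite mul_row_col !mul_scalar_mx.
Qed.

(** The term at 0 is kept apart because the coset of 0 is counted differently from the others. *)
Lemma sum_rowg_leq p (A : 'M[F]_(p, n)) (f : 'rV[F]_n -> nat) B :
  (forall w, (w <= A)%MS -> w != 0 -> (f w <= B)%N) ->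
  (\sum_(w in rowg A) f w <= f 0%R + (#|F| ^ \rank A - 1) * B)%N.
Proof.
move=> fB; rewrite (bigD1 0%R) ?mem_rowg ?sub0mx //= leq_add2l.
have -> : (#|F| ^ \rank A - 1 = \sum_(w in rowg A | w != 0%R) 1)%N.
  rewrite -card_rowg -sum1_card (bigD1 0%R) ?mem_rowg ?sub0mx //=.
  by rewrite addnC addnK.
rewrite big_distrl /=; apply: leq_sum => w /andP[wA w0].
by rewrite mul1n fB // -mem_rowg.
Qed.

(** [A :\: L] is a complement of [A :&: L] in [A], so its vectors [w] represent each coset of
    [A :&: L] exactly once. *)
Lemma card_rowg_split p l (A : 'M[F]_(p, n)) (L : 'M[F]_(l, n))
    (P : pred 'rV[F]_n) :
  #|[set c in rowg A | P c]| =
  \sum_(w in rowg (A :\: L)%MS)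
     #|[set h in rowg (A :&: L)%MS | P (w + h)]|.
Proof.
pose S := [set z : 'rV[F]_n * 'rV[F]_n | [&& z.1 \in rowg (A :\: L)%MS,
  z.2 \in rowg (A :&: L)%MS & P (z.1 + z.2)]].
transitivity #|S|; last first.
  rewrite -sum1_card (eq_bigl (fun z => (z.1 \in rowg (A :\: L)%MS) &&
    (z.2 \in [set h in rowg (A :&: L)%MS | P (z.1 + h)]))); last first.
    by move=> z; rewrite !inE.
  rewrite -(pair_big_dep (fun w => w \in rowg (A :\: L)%MS)
    (fun w h => h \in [set h in rowg (A :&: L)%MS | P (w + h)])
    (fun _ _ => 1%N)) /=.
  by apply: eq_bigr => w _; rewrite sum1_card.
rewrite -(card_in_imset (f := fun z : 'rV[F]_n * 'rV[F]_n => z.1 + z.2)) //.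
  apply: eq_card => c; rewrite [LHS]inE; apply/andP/imsetP => [[cA Pc]|].
    move: cA; rewrite mem_rowg -(addsmx_diff_cap_eq A L) => /sub_addsmxP[[d e]].
    move=> /= def_c; exists (d *m (A :\: L)%MS, e *m (A :&: L)%MS) => //.
    by rewrite inE !mem_rowg !submxMl /= -def_c.
  case=> [[w h]]; rewrite inE /= !mem_rowg => /and3P[wA hA Pwh] ->; split=> //.
  by rewrite addmx_sub ?(submx_trans wA) ?(submx_trans hA) ?diffmxSl ?capmxSl.
move=> [w h] [w' h']; rewrite !inE /= => /and3P[wA hA _] /and3P[wA' hA' _] eq.
have eq' : w - w' = h' - h.
  by apply/eqP; rewrite subr_eq addrAC eq_sym subr_eq eq_sym eq addrC.
have : (w - w' <= (A :\: L) :&: L)%MS.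
  rewrite sub_capmx addmx_sub ?eqmx_opp //= eq'.
  by apply: submx_trans (capmxSr A L); rewrite addmx_sub ?eqmx_opp.
rewrite capmx_diff submx0 => /eqP d0.
by rewrite (subr0_eq d0) -(subr0_eq (etrans (esym eq') d0)).
Qed.

End RowSpaces.

(** * Decomposable vectors and the subspaces [x /\ V] *)

Section Decomposable.

Variables (F : finFieldType) (m : nat).
Notation N := #|{: rsets m 2}|.
Implicit Types (u v x y a b : 'rV[F]_m) (c : 'rV[F]_N).

Definition decomposable c := [exists u, exists v, c == pluecker u v].

Lemma decomposableP c :
  reflect (exists u v, c = pluecker u v) (decomposable c).
Proof.
by apply: (iffP existsP) => [[u /existsP[v /eqP]]|[u [v ->]]];
  exists u; [exists v | apply/existsP; exists v].
Qed.

Lemma rank_alt_pluecker u v :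
  row_free (col_mx u v) -> \rank (alt (pluecker u v)) = 2%N.
Proof. by rewrite alt_pluecker => /rank_alt_hyperbolic. Qed.

Lemma rank_alt_pluecker_le u v : (\rank (alt (pluecker u v)) <= 2)%N.
Proof.
rewrite alt_pluecker (leq_trans (mxrank_add _ _)) // mxrank_opp.
by apply: (@leq_add _ _ 1 1); apply: mulmx_max_rank.
Qed.

Lemma pluecker_eq0 u v : (pluecker u v == 0) = ~~ row_free (col_mx u v).
Proof.
apply/eqP/idP=> [uv0|].
  by apply/negP=> /rank_alt_pluecker; rewrite uv0 linear0 mxrank0.
rewrite row_free_col_rV negb_and !negbK => /orP[/eqP->|/sub_rVP[t ->]].
  by rewrite linear0.
by rewrite plueckerZl plueckerxx scaler0.
Qed.

(** Both sides have rank 2 and one contains the other. A plane can thus be recovered from its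
    Plücker vector. *)
Lemma eqmx_alt_pluecker u v :
  row_free (col_mx u v) -> (alt (pluecker u v) :=: col_mx u v)%MS.
Proof.
move=> free_uv; apply/eqmxP.
rewrite -(geq_leqif (mxrank_leqif_eq _)) ?rank_alt_pluecker ?(eqP free_uv) //.
rewrite alt_pluecker addmx_sub ?eqmx_opp //.
  by apply: submx_trans (submxMl _ _) _; rewrite -addsmxE addsmxSr.
by apply: submx_trans (submxMl _ _) _; rewrite -addsmxE addsmxSl.
Qed.

Lemma pluecker_sub u v a b : (u <= col_mx a b)%MS -> (v <= col_mx a b)%MS ->
  exists t, pluecker u v = t *: pluecker a b.
Proof.
move=> /sub_col_rVP[s [t ->]] /sub_col_rVP[s' [t' ->]].
exists (s * t' - t * s'); rewrite plueckerDl !plueckerZl !linearP !linearZ /=.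
rewrite !plueckerxx [pluecker b a]plueckerC !scaler0 addr0 add0r !scalerN.
by rewrite scalerBl !scalerA [t' * s]mulrC.
Qed.

(** If [y] were outside [<x, a, b>], the left side would have an alternating matrix of rank 4,
    whereas a decomposable vector gives rank at most 2. *)
Lemma sub_pluecker_sum x y a b u v :
    row_free (col_mx x (col_mx a b)) ->
    pluecker x y + pluecker a b = pluecker u v ->
  (y <= col_mx x (col_mx a b))%MS.
Proof.
move=> free_xab eq_uv; apply: contraT => yxab.
(* The vectors are paired as [(x, y)] and [(a, b)], so that the hyperbolic form of [Z] is the sum of
   the two wedge products. *)
set Z := col_mx (col_mx x a) (col_mx y b).
have freeZ : row_free Z.
  rewrite /row_free eqn_leq rank_leq_row.
  rewrite -[X in (X <= _)%N](eqP (row_free_cons free_xab yxab)) mxrankS //.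
  move: (submx_refl Z); rewrite {1}/Z !col_mx_sub.
  by case/andP=> /andP[-> ->] /andP[-> ->].
have := rank_alt_hyperbolic freeZ; rewrite !tr_col_mx !mul_row_col.
rewrite opprD addrACA -!alt_pluecker -linearD /= eq_uv => rk.
by have := rank_alt_pluecker_le u v; rewrite rk.
Qed.

Definition pluecker_mx x : 'M[F]_(m, N) := lin1_mx (pluecker x).

Lemma mul_pluecker_mx x y : y *m pluecker_mx x = pluecker x y.
Proof. by rewrite mul_rV_lin1. Qed.

Lemma sub_pluecker_mxP x c :
  reflect (exists y, c = pluecker x y) (c <= pluecker_mx x)%MS.
Proof.
by apply: (iffP submxP) => [] [y ->]; exists y; rewrite mul_pluecker_mx.
Qed.

(** The kernel of [y |-> x /\ y] is the line spanned by [x]. *)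
Lemma rank_pluecker_mx x : x != 0 -> \rank (pluecker_mx x) = m.-1.
Proof.
move=> x0; have : \rank (kermx (pluecker_mx x)) = \rank x.
  apply: eqmx_rank; apply/andP; split; last first.
    by apply/sub_kermxP; rewrite mul_pluecker_mx plueckerxx.
  apply/rV_subP=> y /sub_kermxP; rewrite mul_pluecker_mx plueckerC.
  move/eqP; rewrite oppr_eq0 pluecker_eq0 row_free_col_rV x0 /=.
  by rewrite negbK.
rewrite mxrank_ker rank_rV x0; have := rank_leq_row (pluecker_mx x); lia.
Qed.

(** A linear relation either makes [a /\ b] zero or puts [x] in [<a, b>]. In the second case
    [a /\ b] is a multiple of [x /\ b] or of [x /\ a]. *)
Lemma row_free_outside x a b :
    x != 0 -> ~~ (pluecker a b <= pluecker_mx x)%MS ->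
  row_free (col_mx x (col_mx a b)).
Proof.
move=> x0 abx; apply: row_free_cons.
  by rewrite -[row_free _]negbK -pluecker_eq0; apply: contra abx => /eqP->;
    rewrite sub0mx.
apply: contra abx => /sub_col_rVP[s [t def_x]]; apply/sub_pluecker_mxP.
have [s0|s0] := eqVneq s 0; last first.
  exists (s^-1 *: b); rewrite def_x plueckerDl !plueckerZl !linearZ /=.
  by rewrite plueckerxx !scaler0 addr0 scalerA mulVf ?scale1r.
move: def_x; rewrite s0 scale0r add0r => def_x.
have t0 : t != 0 by apply: contraNneq x0 => t0; rewrite def_x t0 scale0r.
exists (- t^-1 *: a); rewrite def_x plueckerZl linearZ /= scaleNr scalerN.
by rewrite scalerA divff // scale1r -plueckerC.
Qed.

End Decomposable.

(** * The bound on decomposable vectors in a subspace of dimension [m] *)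

Section DecomposableCount.

Variables (F : finFieldType) (m : nat).
Notation N := #|{: rsets m 2}|.
Notation q := #|F|.
Implicit Types (u v x y a b : 'rV[F]_m) (c w h : 'rV[F]_N).

Lemma q_gt1 : (1 < q)%N.
Proof. exact: card_finNzRing_gt1. Qed.

Lemma sub_col_consP x y p (A : 'M[F]_(p, m)) :
  (y <= col_mx x A)%MS -> exists t z, (z <= A)%MS /\ y = t *: x + z.
Proof.
case/submxP=> D ->; exists (lsubmx D 0 0), (rsubmx D *m A); split.
  exact: submxMl.
by rewrite -{1}[D]hsubmxK mul_row_col -mul_scalar_mx -mx11_scalar.
Qed.

(** Modulo [x /\ V], the exterior square of [<x, a, b>] is spanned by [a /\ b] alone. *)
Lemma pluecker_sub_mod x a b u v :
    (u <= col_mx x (col_mx a b))%MS -> (v <= col_mx x (col_mx a b))%MS ->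
  exists t, (pluecker u v - t *: pluecker a b <= pluecker_mx x)%MS.
Proof.
move=> /sub_col_consP[s [u' [u'ab ->]]] /sub_col_consP[s' [v' [v'ab ->]]].
have [t def_uv] := pluecker_sub u'ab v'ab; exists t.
rewrite plueckerDl !linearD /= def_uv !plueckerZl !linearZ /= plueckerxx.
rewrite !scaler0 add0r scalerN addrA addrK [pluecker u' x]plueckerC.
by rewrite addmx_sub // scalemx_sub ?eqmx_opp -?mul_pluecker_mx ?submxMl.
Qed.

(** The decomposable vectors of the coset of [w] are recorded by their differences from [w]. *)
Definition fiber x w p (A : 'M[F]_(p, N)) : {set 'rV[F]_N} :=
  [set h in rowg (A :&: pluecker_mx x)%MS | decomposable (w + h)].

Lemma card_fiber0 x p (A : 'M[F]_(p, N)) :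
  (#|fiber x 0 A| <= q ^ \rank (A :&: pluecker_mx x)%MS)%N.
Proof.
rewrite -card_rowg subset_leq_card //; apply/subsetP=> h.
by rewrite inE => /andP[].
Qed.

(** One decomposable member [a /\ b] of the coset controls the others: they differ from it by
    elements of [x /\ <a, b>] lying in [A]. *)
Lemma fiber_bound x w h p (A : 'M[F]_(p, N)) :
    x != 0 -> ~~ (w <= pluecker_mx x)%MS -> h \in fiber x w A ->
  exists a b, [/\ row_free (col_mx x (col_mx a b)), w + h = pluecker a b
    & (#|fiber x w A| <= q ^ \rank (col_mx a b *m pluecker_mx x :&: A)%MS)%N].
Proof.
move=> x0 wx; rewrite inE mem_rowg sub_capmx => /andP[/andP[hA hx]].
case/decomposableP=> a [b def_ab]; exists a, b.
have abx : ~~ (pluecker a b <= pluecker_mx x)%MS.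
  apply: contra wx => abx; rewrite -[w](addrK h) def_ab.
  by rewrite addmx_sub ?eqmx_opp.
have free_xab := row_free_outside x0 abx; split=> //.
rewrite -card_rowg.
set B := (_ :&: A)%MS; rewrite -(card_imset (rowg B) (addrI h)).
apply: subset_leq_card; apply/subsetP=> h'.
rewrite inE mem_rowg sub_capmx => /andP[/andP[h'A h'x]].
case/decomposableP=> u [v def_uv]; apply/imsetP; exists (h' - h); last first.
  by rewrite addrC subrK.
rewrite mem_rowg sub_capmx andbC addmx_sub ?eqmx_opp //=.
have : (h' - h <= pluecker_mx x)%MS by rewrite addmx_sub ?eqmx_opp.
case/sub_pluecker_mxP=> y def_y.
have /(sub_pluecker_sum free_xab) : pluecker x y + pluecker a b = pluecker u v.
  by rewrite -def_y -def_ab -def_uv addrC addrA addrAC addrK.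
(* The component of [y] along [x] dies in [x /\ y], so [y] may be replaced by [z] in [<a, b>]. *)
case/sub_col_consP=> t [z [zab def_z]]; rewrite def_y def_z.
by rewrite linearD linearZ /= plueckerxx scaler0 add0r -mul_pluecker_mx submxMr.
Qed.

Lemma card_fiber_le x w p (A : 'M[F]_(p, N)) B :
    x != 0 -> ~~ (w <= pluecker_mx x)%MS ->
    (forall a b h, row_free (col_mx x (col_mx a b)) ->
       (h <= A :&: pluecker_mx x)%MS -> w + h = pluecker a b ->
       (\rank (col_mx a b *m pluecker_mx x :&: A)%MS <= B)%N) ->
  (#|fiber x w A| <= q ^ B)%N.
Proof.
move=> x0 wx rkB; have [->|[h hE]] := set_0Vmem (fiber x w A).
  by rewrite cards0.
have [a [b [free_xab def_ab le_E]]] := fiber_bound x0 wx hE.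
apply: leq_trans le_E _; rewrite leq_exp2l ?q_gt1 //.
by apply: rkB def_ab => //; move: hE; rewrite inE mem_rowg => /andP[].
Qed.

Lemma rank_cap_col2 x a b p (A : 'M[F]_(p, N)) :
  (\rank (col_mx a b *m pluecker_mx x :&: A)%MS <= 2)%N.
Proof.
by apply: leq_trans (mxrankS (capmxSl _ _)) _; apply: rank_leq_row.
Qed.

Lemma notin_compl x w p (A : 'M[F]_(p, N)) :
    (w <= A :\: pluecker_mx x)%MS -> w != 0 -> ~~ (w <= pluecker_mx x)%MS.
Proof.
move=> wA; apply: contra => wx; rewrite -submx0 -(capmx_diff A (pluecker_mx x)).
by rewrite sub_capmx wA.
Qed.

Lemma count_ge3 x p (A : 'M[F]_(p, N)) :
    \rank A = m -> x != 0 -> (2 < \rank (A :&: pluecker_mx x)%MS)%N ->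
  (#|[set c in rowg A | decomposable c]| + q ^ 2 <= q ^ m.-1 + q ^ 3)%N.
Proof.
move=> rkA x0 s3; rewrite (card_rowg_split A (pluecker_mx x)).
have le_sum := @sum_rowg_leq _ _ _ (A :\: pluecker_mx x)%MS
  (fun w => #|fiber x w A|) (q ^ 2) _.
apply: leq_trans (leq_add (le_sum _) (leqnn _)) _ => [w wA w0|].
  by apply: card_fiber_le (notin_compl wA w0) _ => // *; apply: rank_cap_col2.
have := card_fiber0 x A; have := mxrank_cap_compl A (pluecker_mx x).
have : (\rank (A :&: pluecker_mx x)%MS <= m.-1)%N.
  by rewrite -(rank_pluecker_mx x0) mxrankS ?capmxSr.
move: s3 (q_gt1); rewrite rkA.
move: (\rank (A :&: _)%MS) (\rank (A :\: _)%MS) #|fiber x 0 A| => s r f.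
move=> s3 q1 sm srm fs.
have [s' def_s] : exists s', s = (s' + 3)%N by exists (s - 3)%N; lia.
have [r' def_r] : exists r', r = r'.+1 by exists r.-1; lia.
have -> : m.-1 = (s' + r' + 3)%N by lia.
rewrite {}def_s {}def_r in fs *; move: fs; rewrite !expnD => fs.
(* This is the convexity in [s], in the form [(q ^ s' - 1) * (q ^ r' - 1) >= 0]. The shifts by 3 and
   1 let a factor [q ^ 3] come out of the whole inequality. *)
have le_SR : (q ^ s' + q ^ r' <= q ^ s' * q ^ r' + 1)%N.
  have : (0 < q ^ s')%N by rewrite expn_gt0; lia.
  by have : (0 < q ^ r')%N; [rewrite expn_gt0; lia | nia].
have -> : (f + (q ^ r'.+1 - 1) * q ^ 2 + q ^ 2 = f + q ^ r' * q ^ 3)%N.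
  rewrite -addnA -[X in (_ + (_ + X))%N]mul1n -mulnDl subnK ?expn_gt0; last lia.
  by congr addn; rewrite -!expnD; congr expn; lia.
apply: leq_trans (leq_add fs (leqnn _)) _.
by rewrite -mulnDl -[X in (_ <= _ + X)%N]mul1n -mulnDl leq_mul2r le_SR orbT.
Qed.

(* If the fibers over [w0] and [w1] both have more than [q] elements, then [A]
   contains the exterior square of a 3-space [<x, a, b>] which is determined by
   [A :&: x /\ V], so that [w0] and [w1] are proportional. *)
Lemma large_fiber_line x w0 w1 p (A : 'M[F]_(p, N)) :
    x != 0 -> \rank (A :&: pluecker_mx x)%MS = 2%N ->
    (w0 <= A :\: pluecker_mx x)%MS -> w0 != 0 -> (q < #|fiber x w0 A|)%N ->
    (w1 <= A :\: pluecker_mx x)%MS -> w1 != 0 -> (q < #|fiber x w1 A|)%N ->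
  (w1 <= w0)%MS.
Proof.
move=> x0 s2.
(* More than [q] elements force the whole of [x /\ <a, b>], of dimension 2, into [A], where it fills
   [A :&: x /\ V]. *)
have large w : (w <= A :\: pluecker_mx x)%MS -> w != 0 ->
    (q < #|fiber x w A|)%N ->
  exists a b, [/\ (w - pluecker a b <= pluecker_mx x)%MS
    & (A :&: pluecker_mx x :=: col_mx a b *m pluecker_mx x)%MS].
  move=> wA wn0 ltqE; have wx := notin_compl wA wn0.
  have [E0|[h hE]] := set_0Vmem (fiber x w A).
    by rewrite E0 cards0 in ltqE.
  have [a [b [free_xab def_ab le_E]]] := fiber_bound x0 wx hE.
  have lt1 := leq_trans ltqE le_E.
  rewrite -{1}[q]expn1 ltn_exp2l ?q_gt1 // in lt1.
  exists a, b; split.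
    rewrite -def_ab opprD addrA subrr add0r eqmx_opp.
    by move: hE; rewrite inE mem_rowg sub_capmx => /andP[/andP[]].
  set B := _ *m _ in lt1 *.
  have leB : (B :&: A <= A :&: pluecker_mx x)%MS.
    by rewrite sub_capmx capmxSr (submx_trans (capmxSl _ _)) ?submxMl.
  have rk2 : \rank (B :&: A)%MS = 2%N.
    by apply/eqP; rewrite eqn_leq lt1 rank_cap_col2.
  have eq1 : (B :&: A :=: A :&: pluecker_mx x)%MS.
    by apply/eqmxP; rewrite -(geq_leqif (mxrank_leqif_eq leB)) rk2 s2.
  apply: eqmx_trans (eqmx_sym eq1) _; apply/eqmxP.
  by rewrite -(geq_leqif (mxrank_leqif_eq (capmxSl _ _))) rk2 rank_leq_row.
move=> w0A w0n0 E0 w1A w1n0 E1.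
have [a [b [w0ab eqB]]] := large w0 w0A w0n0 E0.
have [u [v [w1uv eqB1]]] := large w1 w1A w1n0 E1.
(* [x /\ y] equals [x /\ z] for some [z] in [<a, b>], and then [y - z] is a multiple of [x]. *)
have sub_xab y : (y <= col_mx u v)%MS -> (y <= col_mx x (col_mx a b))%MS.
  move=> yuv; have : (y *m pluecker_mx x <= col_mx a b *m pluecker_mx x)%MS.
    by rewrite -eqB eqB1 submxMr.
  case/submxP=> D; rewrite mulmxA => /eqP; rewrite -subr_eq0 -mulmxBl.
  rewrite mul_pluecker_mx plueckerC oppr_eq0 pluecker_eq0 row_free_col_rV x0 /=.
  rewrite negbK -addsmxE => yx.
  rewrite -[y](subrK (D *m col_mx a b)) addmx_sub //.
    exact: submx_trans yx (addsmxSl _ _).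
  by apply: submx_trans (addsmxSr _ _); apply: submxMl.
have [] := @pluecker_sub_mod x a b u v.
- by apply: sub_xab; rewrite -addsmxE addsmxSl.
- by apply: sub_xab; rewrite -addsmxE addsmxSr.
(* [w1 - t *: w0] lies in [x /\ V] and also in the complement [A :\: x /\ V], so it vanishes. *)
move=> t uvx; apply/sub_rVP; exists t; apply/eqP; rewrite -subr_eq0 -submx0.
rewrite -(capmx_diff A (pluecker_mx x)) sub_capmx.
rewrite addmx_sub ?eqmx_opp ?scalemx_sub //=.
have -> : w1 - t *: w0 = (w1 - pluecker u v) +
    (pluecker u v - t *: pluecker a b) - t *: (w0 - pluecker a b).
  by rewrite scalerBr opprB !addrA !subrK.
by rewrite addmx_sub ?eqmx_opp ?(scalemx_sub _ w0ab) // addmx_sub.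
Qed.

(** Every nonzero coset is charged [q], and those on the exceptional line a surplus [q ^ 2 - q].
    With at most [q ^ 2] for the zero coset, these charges add up exactly to the bound. *)
Lemma count_eq2 x p (A : 'M[F]_(p, N)) :
    \rank A = m -> x != 0 -> \rank (A :&: pluecker_mx x)%MS = 2%N ->
  (#|[set c in rowg A | decomposable c]| + q ^ 2 <= q ^ m.-1 + q ^ 3)%N.
Proof.
move=> rkA x0 s2; rewrite (card_rowg_split A (pluecker_mx x)).
set W := (A :\: _)%MS.
have [w0 w0P] : exists w0 : 'rV[F]_N, forall w, (w <= W)%MS -> w != 0 ->
    (q < #|fiber x w A|)%N -> (w <= w0)%MS.
  have [/existsP[w0 /and3P[w0W w0n0 E0]]|no] := boolP [exists w : 'rV[F]_N,
      [&& (w <= W)%MS, w != 0 & (q < #|fiber x w A|)%N]].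
    by exists w0 => w wW wn0 E; apply: large_fiber_line s2 w0W w0n0 E0 wW wn0 E.
  (* Without large fibers any [w0] would do. *)
  exists 0 => w wW wn0 E; case/existsP: no; exists w; exact/and3P.
pose i (w : 'rV[F]_N) := (((w <= w0)%MS && (w != 0%R)) * (q ^ 2 - q))%N.
have le_q2 : (q <= q ^ 2)%N by rewrite -{1}[q]expn1 leq_exp2l ?q_gt1.
have le_i : (\sum_(w in rowg W) i w <= (q - 1) * (q ^ 2 - q))%N.
  apply: (@leq_trans (\sum_(w in rowg w0) i w)).
    rewrite big_mkcond [X in (_ <= X)%N]big_mkcond; apply: leq_sum => w _.
    by rewrite !mem_rowg /i; case: (w <= w0)%MS => /=; case: ifP.
  apply: leq_trans (sum_rowg_leq (B := q ^ 2 - q) _) _.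
    by move=> w _ wn0; rewrite /i wn0 andbT; case: (w <= w0)%MS; rewrite ?mul1n.
  rewrite {1}/i eqxx andbF mul0n add0n leq_mul2r leq_sub2r ?orbT //.
  by rewrite -[X in (_ <= X)%N]expn1 leq_exp2l ?q_gt1 ?rank_leq_row.
have le_f : (\sum_(w in rowg W) (#|fiber x w A| - i w) <=
    q ^ 2 + (q ^ \rank W - 1) * q)%N.
  apply: leq_trans (sum_rowg_leq (B := q) _) _ => [w wW wn0|]; last first.
    rewrite leq_add2r /i eqxx andbF mul0n subn0.
    by apply: leq_trans (card_fiber0 _ _) _; rewrite s2.
  have wx := notin_compl wW wn0; rewrite leq_subLR /i wn0 andbT.
  have [ww0|/negP ww0] := boolP (w <= w0)%MS.
    rewrite mul1n subnK //; apply: card_fiber_le wx _ => // *.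
    exact: rank_cap_col2.
  by rewrite mul0n add0n leqNgt; apply/negP=> /(w0P _ wW wn0).
have : (\sum_(w in rowg W) #|fiber x w A| <=
    \sum_(w in rowg W) (#|fiber x w A| - i w) + \sum_(w in rowg W) i w)%N.
  by rewrite -big_split; apply: leq_sum => w _; rewrite /= addnC -leq_subLR.
have := mxrank_cap_compl A (pluecker_mx x); rewrite s2 rkA -/W.
rewrite /fiber; move: (\sum_(w in _) #|_|) (\sum_(w in _) i w) le_i.
move: (\sum_(w in _) _) (\rank W) le_f q_gt1 le_q2 => f r le_f q1 le_q2 j g.
move=> le_j def_m le_g; have -> : m.-1 = r.+1 by lia.
have : (0 < q ^ r)%N by rewrite expn_gt0; lia.
move: le_f; rewrite !expnS expn0 !muln1 in le_q2 le_j *.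
move: (q ^ r)%N => R; nia.
Qed.

Lemma count_eq1 x p (A : 'M[F]_(p, N)) :
    \rank A = m -> x != 0 -> \rank (A :&: pluecker_mx x)%MS = 1%N ->
    (forall y, y != 0 -> (\rank (A :&: pluecker_mx y)%MS <= 1)%N) ->
  (#|[set c in rowg A | decomposable c]| + q ^ 2 <= q ^ m.-1 + q ^ 3)%N.
Proof.
move=> rkA x0 s1 le1; rewrite (card_rowg_split A (pluecker_mx x)).
have le_sum := @sum_rowg_leq _ _ _ (A :\: pluecker_mx x)%MS
  (fun w => #|fiber x w A|) (q ^ 0) _.
apply: leq_trans (leq_add (le_sum _) (leqnn _)) _ => [w wA w0|].
  have wx := notin_compl wA w0.
  apply: card_fiber_le (wx) _ => // a b h free_xab hA def_ab.
  rewrite leqn0 mxrank_eq0; apply: contraT => /rowV0Pn[c].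
  rewrite sub_capmx => /andP[/submxP[D ->] cA] c0.
  pose y := D *m col_mx a b; rewrite mulmxA mul_pluecker_mx -/y in cA c0.
  have y0 : y != 0 by apply: contraNneq c0 => ->; rewrite linear0.
  have abA : (pluecker a b <= A)%MS.
    rewrite -def_ab addmx_sub ?(submx_trans hA) ?capmxSl //.
    exact: submx_trans wA (diffmxSl _ _).
  have abx : ~~ (pluecker a b <= pluecker_mx x)%MS.
    apply: contra wx => abx.
    rewrite -[w](addrK h) def_ab addmx_sub ?eqmx_opp //.
    exact: submx_trans hA (capmxSr _ _).
  (* Since [y] lies in [<a, b>], both [a /\ b] and [x /\ y] belong to [y /\ V]. They are independent
     vectors of [A], which contradicts [le1]. *)
  have := le1 y y0; rewrite leqNgt => /negP[].
  have : row_free (col_mx (pluecker a b) (pluecker x y)).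
    rewrite row_free_col_rV c0; apply: contra abx => abxy.
    by apply: submx_trans abxy _; rewrite -mul_pluecker_mx submxMl.
  move/eqP=> rk2; apply: leq_trans (eq_leq (esym rk2)) (mxrankS _).
  rewrite col_mx_sub !sub_capmx abA cA /=.
  rewrite [pluecker x y]plueckerC eqmx_opp -(mul_pluecker_mx y x) submxMl.
  rewrite andbT; apply: contraT => /(row_free_outside y0).
  rewrite /row_free -addsmxE => /eqP.
  have /addsmx_idPr -> : (y <= col_mx a b)%MS by apply: submxMl.
  by move=> rk3; have := rank_leq_row (col_mx a b); rewrite rk3.
have := card_fiber0 x A; rewrite s1; have := mxrank_cap_compl A (pluecker_mx x).
rewrite s1 rkA => def_m; have -> : \rank (A :\: pluecker_mx x)%MS = m.-1 by lia.
have := q_gt1; have : (0 < q ^ m.-1)%N by rewrite expn_gt0; have := q_gt1; lia.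
move: (q ^ m.-1)%N #|fiber x 0 A| => R f; rewrite !expnS expn0; nia.
Qed.

Theorem card_decomposable_le p (A : 'M[F]_(p, N)) : \rank A = m ->
  (#|[set c in rowg A | decomposable c]| + q ^ 2 <= q ^ m.-1 + q ^ 3)%N.
Proof.
move=> rkA.
have [/existsP[x /andP[x0 s3]]|no3] := boolP [exists x : 'rV[F]_m,
  (x != 0) && (2 < \rank (A :&: pluecker_mx x)%MS)%N].
  exact: count_ge3 s3.
have [/existsP[x /andP[x0 /eqP s2]]|no2] := boolP [exists x : 'rV[F]_m,
  (x != 0) && (\rank (A :&: pluecker_mx x)%MS == 2)%N].
  exact: count_eq2 s2.
have le1 y : y != 0 -> (\rank (A :&: pluecker_mx y)%MS <= 1)%N.
  move=> y0; move: no2 no3; rewrite !negb_exists => /forallP/(_ y).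
  by move=> no2 /forallP/(_ y); move: no2; rewrite y0 /=; lia.
have [/existsP[x /andP[x0 /eqP s1]]|no1] := boolP [exists x : 'rV[F]_m,
  (x != 0) && (\rank (A :&: pluecker_mx x)%MS == 1)%N].
  exact: count_eq1 s1 le1.
(* Now [A] meets every [x /\ V] trivially, and a nonzero [u /\ v] in [A] would lie in [u /\ V]. *)
have -> : [set c in rowg A | decomposable c] = [set 0].
  apply/setP=> c; rewrite !inE; apply/andP/eqP=> [[cA]|->]; last first.
    split; first exact: sub0mx.
    by apply/decomposableP; exists 0, 0; rewrite plueckerxx.
  case/decomposableP=> u [v def_c]; apply/eqP; apply: contraT => c0.
  have u0 : u != 0.
    apply: contraNneq c0 => u0.
    by rewrite def_c u0 plueckerC linear0 oppr0.
  move: no1; rewrite negb_exists => /forallP/(_ u).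
  rewrite u0 /= eqn_leq le1 //=.
  rewrite -ltnNge ltnS leqn0 mxrank_eq0 => /eqP cap0.
  move: c0; rewrite -submx0 -cap0 sub_capmx cA def_c.
  by rewrite -mul_pluecker_mx submxMl.
rewrite cards1; have := q_gt1.
have : (0 < q ^ m.-1)%N by rewrite expn_gt0; have := q_gt1; lia.
by rewrite !expnS expn0; nia.
Qed.

End DecomposableCount.

(** * A subspace attaining the bound *)

Section ExtremalSubspace.

Variables (F : finFieldType) (m : nat).
Notation N := #|{: rsets m 2}|.
Notation q := #|F|.
Implicit Types (u v x y a b : 'rV[F]_m) (c : 'rV[F]_N).

(** If [a /\ b = x /\ y], the planes [<a, b>] and [<x, y>] coincide, so [x] lies in [<a, b>]. *)
Lemma pluecker_outside x a b : row_free (col_mx x (col_mx a b)) ->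
  ~~ (pluecker a b <= pluecker_mx x)%MS.
Proof.
move=> free_xab; apply/negP=> /sub_pluecker_mxP[y eq_xy].
have xab : ~~ (x <= col_mx a b)%MS.
  apply/negP=> /addsmx_idPr xab; move: free_xab.
  rewrite /row_free -addsmxE xab => /eqP rk3.
  by have := rank_leq_row (col_mx a b); rewrite rk3.
have free_ab : row_free (col_mx a b).
  rewrite /row_free eqn_leq rank_leq_row /= -ltnS.
  by rewrite -(rank_addsmx_row xab) addsmxE (eqP free_xab).
have free_xy : row_free (col_mx x y).
  by rewrite -[row_free _]negbK -pluecker_eq0 -eq_xy pluecker_eq0 negbK.
case/negP: xab; rewrite -(eqmx_alt_pluecker free_ab) eq_xy.
by rewrite (eqmx_alt_pluecker free_xy) -addsmxE addsmxSl.
Qed.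

Definition extremal x a b : 'M[F]_N := (pluecker a b + pluecker_mx x)%MS.

Lemma rank_extremal x a b : row_free (col_mx x (col_mx a b)) -> x != 0 ->
  \rank (extremal x a b) = m.
Proof.
move=> free_xab x0; rewrite rank_addsmx_row ?pluecker_outside //.
rewrite rank_pluecker_mx // prednK //.
apply: leq_trans (rank_leq_col (col_mx x (col_mx a b))).
by rewrite (eqP free_xab).
Qed.

Lemma rank_alt_extremal x a b c :
  (c <= extremal x a b)%MS -> (\rank (alt c) <= 4)%N.
Proof.
case/sub_addsmxP=> [[s y] /= ->].
rewrite linearD /= mul_pluecker_mx [s]mx11_scalar mul_scalar_mx -plueckerZl.
apply: leq_trans (mxrank_add _ _) _.
by apply: (@leq_add _ _ 2 2); apply: rank_alt_pluecker_le.
Qed.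

(** Besides the [q ^ m.-1] vectors of [x /\ V], the vectors [t (a + g x) /\ (b + d x)] with [t]
    nonzero give [(q - 1) q ^ 2] further ones. *)
Lemma card_decomposable_extremal_ge x a b :
    row_free (col_mx x (col_mx a b)) -> x != 0 ->
  (q ^ m.-1 + q ^ 3 <=
     #|[set c in rowg (extremal x a b) | decomposable c]| + q ^ 2)%N.
Proof.
move=> free_xab x0; have abx := pluecker_outside free_xab.
pose f (z : F * (F * F)) : 'rV[F]_N :=
  z.1 *: pluecker (a + z.2.1 *: x) (b + z.2.2 *: x).
have fE z : f z = z.1 *: pluecker a b +
    pluecker x (z.1 *: (z.2.1 *: b - z.2.2 *: a)).
  rewrite /f scalerBr linearB /= plueckerDl plueckerZl !linearD /= !plueckerZr.
  rewrite plueckerxx !scaler0 addr0 [pluecker a x]plueckerC !scalerN.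
  by rewrite -addrA [X in _ + X]addrC.
have f_out z : z.1 != 0 -> ~~ (f z <= pluecker_mx x)%MS.
  move=> z0; apply: contra abx; rewrite fE -(mul_pluecker_mx x) => zx.
  have : (z.1 *: pluecker a b <= pluecker_mx x)%MS.
    set y := z.1 *: (_ - _) in zx; rewrite -[_ *: _](addrK (y *m pluecker_mx x)).
    by rewrite addmx_sub ?eqmx_opp ?submxMl.
  by rewrite eqmx_scale.
have f_inj : {in [pred z | z.1 != 0] &, injective f}.
  move=> [t [g d]] [t' [g' d']]; rewrite !inE /= => t0 t'0 eq_f.
  (* Modulo [x /\ V] only [t *: (a /\ b)] survives, which determines [t]. The independence of
     [x, a, b] then determines [g] and [d]. *)
  have tt' : t = t'.
    apply/eqP; rewrite -subr_eq0; apply: contraR abx => tt'.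
    rewrite -(eqmx_scale _ tt') scalerBl.
    have := congr1 (fun c => c - t' *: pluecker a b) eq_f.
    rewrite !fE /= addrAC [RHS]addrAC subrr add0r => eq_d.
    rewrite -[X in (X <= _)%MS](addrK (pluecker x (t *: (g *: b - d *: a)))).
    rewrite eq_d -!(mul_pluecker_mx x).
    by rewrite addmx_sub ?eqmx_opp ?submxMl.
  move: eq_f; rewrite !fE /= -tt' => /addrI/eqP.
  rewrite -subr_eq0 -linearB -scalerBr /= linearZ scaler_eq0 (negbTE t0) /=.
  rewrite plueckerC oppr_eq0 pluecker_eq0 row_free_col_rV x0 /= negbK.
  case/sub_rVP=> s /eqP; rewrite -subr_eq0 => /eqP eq0.
  have : row_mx (- s)%:M (row_mx (d' - d)%:M (g - g')%:M) = 0
      :> 'rV[F]_(1 + (1 + 1)).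
    apply: (row_free_inj free_xab); rewrite mul0mx !mul_row_col !mul_scalar_mx.
    by rewrite -[RHS]eq0; apply/rowP=> h; rewrite !mxE; ring.
  rewrite -[RHS]row_mx0 => /eq_row_mx[_]; rewrite -[RHS]row_mx0 => /eq_row_mx[].
  move=> /matrixP/(_ 0 0); rewrite !mxE mulr1n => /subr0_eq->.
  by move=> /matrixP/(_ 0 0); rewrite !mxE mulr1n => /subr0_eq->.
pose S := [set z : F * (F * F) | z.1 != 0].
have card_S : #|f @: S| = (q.-1 * q ^ 2)%N.
  rewrite card_in_imset; last by move=> z z'; rewrite !inE; apply: f_inj.
  have -> : S = setX [set~ 0] setT by apply/setP=> z; rewrite !inE andbT.
  by rewrite cardsX cardsC1 cardsT card_prod.
have disj : [disjoint rowg (pluecker_mx x) & f @: S].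
  rewrite disjoint_sym disjoint_subset; apply/subsetP=> _ /imsetP[z zS ->].
  by rewrite !inE f_out //; rewrite inE in zS.
have sub : rowg (pluecker_mx x) :|: f @: S \subset
    [set c in rowg (extremal x a b) | decomposable c].
  apply/subsetP=> c /setUP[|/imsetP[z _ ->]]; rewrite !inE.
    move=> cx; rewrite (submx_trans cx) ?addsmxSr //=.
    by case/sub_pluecker_mxP: cx => y ->; apply/decomposableP; exists x, y.
  apply/andP; split; last first.
    by apply/decomposableP; rewrite /f -plueckerZl; eexists; eexists.
  by rewrite fE addmx_sub_adds ?scalemx_sub // -(mul_pluecker_mx x) submxMl.
have := subset_leq_card sub.
rewrite cardsU disjoint_setI0 // cards0 subn0 card_S.
rewrite card_rowg rank_pluecker_mx //.
have := q_gt1 F; rewrite !expnS expn0; move: (q ^ _)%N #|_| => R D; nia.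
Qed.

End ExtremalSubspace.

(** * Indecomposable vectors have rank at least 4 *)

Section RankAlternating.

Variables (F : finFieldType) (m : nat).
Notation N := #|{: rsets m 2}|.

(** Symplectic elimination: a nonzero entry [M i j] splits off one decomposable vector. The
    remainder is nonzero, as [c] is indecomposable, and yields two more independent rows. *)
Lemma rank_alt_indecomposable (c : 'rV[F]_N) :
  ~~ decomposable c -> (4 <= \rank (alt c))%N.
Proof.
have alt_neq0 (d : 'rV[F]_N) : d != 0 -> exists i j, alt d i j != 0.
  rewrite -(inj_eq (@alt_inj F m)) linear0 => d0.
  have : [exists i, exists j, alt d i j != 0].
    apply: contraNT d0 => /existsPn no; apply/eqP/matrixP=> i j.
    apply/eqP; rewrite [X in _ == X]mxE.
    by have /existsPn/(_ j) := no i; rewrite negbK.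
  by case/existsP=> i /existsP[j]; exists i, j.
move=> indec; have [|i [j Mij]] := alt_neq0 c.
  apply: contraNneq indec => ->; apply/decomposableP; exists 0, 0.
  by rewrite plueckerxx.
set M := alt c in Mij *.
pose Ri := row i M; pose Rj := row j M.
(* The scalar is chosen so that columns [i] and [j] of [alt d] vanish. *)
pose d := c - (M i j)^-1 *: pluecker Ri Rj.
have [|k [l M'kl]] := alt_neq0 d.
  apply: contraNneq indec => /subr0_eq ->; apply/decomposableP.
  by exists ((M i j)^-1 *: Ri), Rj; rewrite plueckerZl.
have def_M' : alt d = M - (M i j)^-1 *: (Ri^T *m Rj - Rj^T *m Ri).
  by rewrite linearB linearZ /= alt_pluecker.
set M' := alt d in M'kl def_M'.
have entry (A : 'M[F]_m) t k' l' :
    (A - t *: ((row i A)^T *m row j A - (row j A)^T *m row i A)) k' l' =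
    A k' l' - t * (A i k' * A j l' - A j k' * A i l').
  by rewrite !mxE !big_ord1 !mxE.
have M'_i k' : M' k' i = 0.
  rewrite /M' alt_anti -/M' def_M' entry /M alt_diag [alt c j i]alt_anti -/M.
  by rewrite mul0r mulNr sub0r opprK mulrA mulVf // mul1r subrr oppr0.
have M'_j k' : M' k' j = 0.
  rewrite /M' alt_anti -/M' def_M' entry /M alt_diag -/M.
  by rewrite mul0r subr0 mulrA mulVf // mul1r subrr oppr0.
have M'_diag k' : M' k' k' = 0 by apply: alt_diag.
have M'_anti k' l' : M' l' k' = - M' k' l' by apply: alt_anti.
have M_diag k' : M k' k' = 0 by apply: alt_diag.
have M_anti k' l' : M l' k' = - M k' l' by apply: alt_anti.
clearbody M'; clear d; clearbody M.
have Mi : (Ri <= M)%MS by apply: row_sub.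
have Mj : (Rj <= M)%MS by apply: row_sub.
have sM' : (M' <= M)%MS.
  rewrite def_M' addmx_sub ?eqmx_opp ?scalemx_sub // addmx_sub ?eqmx_opp //.
    exact: submx_trans (submxMl _ _) Mj.
  exact: submx_trans (submxMl _ _) Mi.
pose Z := col_mx Ri (col_mx Rj (col_mx (row k M') (row l M'))).
have ZM : (Z <= M)%MS.
  by rewrite !col_mx_sub Mi Mj !(submx_trans (row_sub _ _)).
suff /eqP rkZ : row_free Z.
  exact: leq_trans (eq_leq (esym rkZ)) (mxrankS ZM).
(* Coordinates [i] and [j] separate the rows: those of [M'] vanish at both, [Ri] only at [i] and
   [Rj] only at [j]. *)
have col_ij (w : 'rV[F]_m) h : (h == i) || (h == j) ->
    (w <= col_mx (row k M') (row l M'))%MS -> w 0 h = 0.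
  move=> h_ij /sub_col_rVP[s [t ->]]; rewrite !mxE.
  by case/orP: h_ij => /eqP->; rewrite ?M'_i ?M'_j !mulr0 addr0.
apply: row_free_cons; first apply: row_free_cons.
- rewrite row_free_col_rV; apply/andP; split.
    apply: contraNneq M'kl => /rowP/(_ k); rewrite !mxE M'_anti => /eqP.
    by rewrite oppr_eq0.
  apply: contra M'kl => /sub_rVP[t /rowP/(_ l)]; rewrite !mxE => ->.
  by rewrite M'_diag mulr0.
- apply: contra Mij => /(col_ij _ i); rewrite eqxx !mxE => /(_ isT).
  by rewrite M_anti => /eqP; rewrite oppr_eq0.
apply: contra Mij => /sub_col_consP[s [z [/(col_ij _ j)]]].
rewrite eqxx orbT => /(_ isT) z0 /rowP/(_ j); rewrite !mxE z0 => ->.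
by rewrite M_diag mulr0 addr0.
Qed.

End RankAlternating.

(** * Counting the pairs on which a space of forms does not vanish *)

Section FormCount.

Variables (F : finFieldType) (m : nat).
Notation N := #|{: rsets m 2}|.
Notation q := #|F|.

Lemma card_mul_neq0 n p (B : 'M[F]_(n, p)) :
  #|[set v : 'rV[F]_n | v *m B != 0]| = (q ^ n - q ^ (n - \rank B))%N.
Proof.
have -> : [set v : 'rV[F]_n | v *m B != 0] = ~: rowg (kermx B).
  by apply/setP=> v; rewrite !inE sub_kermx.
by rewrite cardsCs setCK card_rowg mxrank_ker card_mx mul1n.
Qed.

Definition form_count r (c : 'M[F]_(r, N)) :=
  #|[set z : 'rV[F]_m * 'rV[F]_m | c *m (pluecker z.1 z.2)^T != 0]|.

(** The first factor counts the [u] outside the radical of the form. For each of them the functional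
    [v |-> u *m alt c *m v^T] is nonzero. *)
Lemma form_countE (c : 'rV[F]_N) :
  form_count c = ((q ^ m - q ^ (m - \rank (alt c))) * (q ^ m - q ^ (m - 1)))%N.
Proof.
rewrite /form_count -card_mul_neq0 -sum1_card.
rewrite (eq_bigl (fun z => xpredT z.1 && (z.1 *m alt c *m z.2^T != 0)));
  last by move=> z; rewrite inE form_alt.
rewrite -(pair_big_dep xpredT (fun u v => u *m alt c *m v^T != 0)
  (fun _ _ => 1%N)) /=.
rewrite -sum_nat_const [RHS]big_mkcond; apply: eq_bigr => u _; rewrite inE.
have -> : (\sum_(v : 'rV[F]_m | u *m alt c *m v^T != 0%R) 1)%N =
    #|[set v : 'rV[F]_m | v *m (u *m alt c)^T != 0]|.
  rewrite -sum1_card; apply: eq_bigl => v.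
  by rewrite inE -[in RHS]trmx_eq0 trmx_mul trmxK.
rewrite card_mul_neq0 mxrank_tr rank_rV; case: eqP => //= _.
by rewrite subn0 subnn.
Qed.

(** Double counting: a pair on which some row of [X] is nonzero is seen by all combinations [y]
    outside a hyperplane. *)
Lemma form_count_sum r (X : 'M[F]_(r, N)) :
  (form_count X * (q ^ r - q ^ (r - 1)) =
   \sum_(y : 'rV[F]_r) form_count (y *m X))%N.
Proof.
rewrite /form_count.
under [RHS]eq_bigr => y _ do rewrite -sum1_card big_mkcond.
rewrite exchange_big /= -sum_nat_const [LHS]big_mkcond; apply: eq_bigr => z _.
rewrite inE; set b := X *m _.
transitivity #|[set y : 'rV[F]_r | y *m b != 0]|.
  rewrite card_mul_neq0 -mxrank_tr rank_rV trmx_eq0; case: eqP => //= _.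
  by rewrite subn0 subnn.
by rewrite -sum1_card big_mkcond; apply: eq_bigr => y _; rewrite !inE mulmxA.
Qed.

End FormCount.

(** * From ordered pairs of vectors to planes *)

Section PlaneCount.

Variables (F : finFieldType) (m : nat).
Notation q := #|F|.
Implicit Types (u v : 'rV[F]_m) (z : 'rV[F]_m * 'rV[F]_m).

(** The order of [GL_2] over [F], which is the number of ordered bases of a plane. *)
Definition gl2_order := ((q ^ 2 - 1) * (q ^ 2 - q))%N.

Lemma gl2_order_gt0 : (0 < gl2_order)%N.
Proof. by have := q_gt1 F; rewrite /gl2_order !expnS expn0; nia. Qed.

Lemma row_free_colC u v : row_free (col_mx u v) = row_free (col_mx v u).
Proof. by rewrite /row_free -!addsmxE addsmxC. Qed.

Lemma card_free_pairs p (B : 'M[F]_(p, m)) :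
  #|[set z : 'rV[F]_m * 'rV[F]_m |
      [&& (z.1 <= B)%MS, (z.2 <= B)%MS & row_free (col_mx z.1 z.2)]]| =
  ((q ^ \rank B - 1) * (q ^ \rank B - q))%N.
Proof.
transitivity (\sum_(v in rowg B | v != 0%R) #|rowg B :\: rowg v|)%N.
  rewrite -sum1_card (eq_bigl (fun z => ((z.1 \in rowg B) && (z.1 != 0)) &&
    (z.2 \in rowg B :\: rowg z.1))); last first.
    move=> z; rewrite !inE row_free_colC row_free_col_rV.
    by case: (z.1 <= B)%MS; case: (z.2 <= B)%MS; rewrite ?andbF ?andbT.
  rewrite -(pair_big_dep (fun v => (v \in rowg B) && (v != 0))
    (fun v u => u \in rowg B :\: rowg v) (fun _ _ => 1%N)) /=.
  by apply: eq_bigr => v _; rewrite sum1_card.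
have q_v v : (v \in rowg B) && (v != 0) ->
    #|rowg B :\: rowg v| = (q ^ \rank B - q)%N.
  rewrite mem_rowg => /andP[vB v0].
  rewrite cardsD; have /setIidPr -> : rowg v \subset rowg B by rewrite rowgS.
  by rewrite !card_rowg rank_rV v0.
rewrite (eq_bigr _ q_v) sum_nat_const; congr (_ * _)%N.
rewrite -card_rowg (cardD1 0 (mem (rowg B))) mem_rowg sub0mx addKn.
by apply: eq_card => v; rewrite [RHS]inE /= unfold_in /= andbC.
Qed.

Lemma is_plane_span2 u v : row_free (col_mx u v) -> is_plane (span2 u v).
Proof.
move=> free_uv; apply/existsP; exists u; apply/existsP; exists v.
by rewrite eqxx andbT.
Qed.

(** Double counting of incidences between planes and their ordered bases, for a property [P] that
    depends only on the plane spanned. *)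
Lemma card_planes (P : pred ('rV[F]_m * 'rV[F]_m)) (Q : pred (Gr2 F m)) :
    (forall (S : Gr2 F m) u v, row_free (col_mx u v) ->
       val S = span2 u v -> P (u, v) = Q S) ->
  #|[set z : 'rV[F]_m * 'rV[F]_m | row_free (col_mx z.1 z.2) && P z]| =
  (#|[set S | Q S]| * gl2_order)%N.
Proof.
move=> PQ; pose inc (z : 'rV[F]_m * 'rV[F]_m) (S : Gr2 F m) :=
  row_free (col_mx z.1 z.2) && (val S == span2 z.1 z.2).
transitivity (\sum_z \sum_(S | Q S && inc z S) 1)%N.
  rewrite -sum1_card big_mkcond; apply: eq_bigr => [[u v] _]; rewrite inE /=.
  have [free_uv|nfree] := boolP (row_free _); last first.
    by rewrite big_pred0 // => S; rewrite /inc /= (negbTE nfree) andbF.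
  pose S0 : Gr2 F m := Sub (span2 u v) (is_plane_span2 free_uv).
  have incE S : inc (u, v) S = (S == S0) by rewrite /inc /= free_uv -val_eqE.
  rewrite (PQ S0) // andTb; case: ifP => QS0.
    rewrite (big_pred1 S0) // => S; rewrite incE /=.
    by case: eqP => [->|]; rewrite ?QS0 ?andbF.
  rewrite big_pred0 // => S; rewrite incE.
  by case: eqP => [->|]; rewrite ?QS0 ?andbF.
rewrite (exchange_big_dep Q) /= => [|z S _ /andP[] //].
rewrite -sum_nat_const big_mkcond [RHS]big_mkcond.
apply: eq_bigr => S _; rewrite inE; case: ifP => // QS.
have [u /existsP[v /andP[rk /eqP def_S]]] := existsP (valP S).
have := card_free_pairs (col_mx u v); rewrite (eqP rk) -/gl2_order => <-.
rewrite sum1_card.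
apply: eq_card => z; rewrite [RHS]inE unfold_in /inc QS /= [RHS]andbA.
have [free_z|] := boolP (row_free (col_mx z.1 z.2)); last by rewrite andbF.
rewrite andbT def_S -col_mx_sub; apply/eqP/idP=> [eq_uv|sz].
  rewrite col_mx_sub; have zP (w : 'rV[F]_m) :
      (w <= col_mx z.1 z.2)%MS = (w <= col_mx u v)%MS.
    by move/setP/(_ w): eq_uv; rewrite !inE.
  by rewrite -!zP -!addsmxE addsmxSl addsmxSr.
have /eqmxP eq_z : (col_mx z.1 z.2 == col_mx u v)%MS.
  by rewrite -(geq_leqif (mxrank_leqif_eq sz)) (eqP rk) (eqP free_z).
by apply/setP=> w; rewrite !inE eq_z.
Qed.

End PlaneCount.

(** * The Grassmann code: generator matrix, supports and annihilators *)

Section GrassmannCode.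

Variables (F : finFieldType) (m : nat) (rep : Gr2 F m -> wedge F m 2).
Hypothesis m_gt4 : (4 < m)%N.
Hypothesis repP : good_reps rep.
Notation N := #|{: rsets m 2}|.
Notation n := #|{: Gr2 F m}|.
Notation q := #|F|.

Lemma card_rsets : N = 'C(m, 2).
Proof. by rewrite card_sig -cardsE card_draws card_ord. Qed.

Definition generator : 'M[F]_(N, n) :=
  \matrix_(k, j) rep (enum_val j) (enum_val k).

(** The representative may come from another basis of the plane, which changes the Plücker vector by
    a nonzero determinant. *)
Lemma col_generator (S : Gr2 F m) u v : row_free (col_mx u v) ->
    val S = span2 u v ->
  exists2 t, t != 0 &
    pluecker u v = t *: (col (enum_rank S) generator)^T.
Proof.
move=> free_uv def_S; have [a [b [rk [def_S' def_rep]]]] := repP S.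
have -> : (col (enum_rank S) generator)^T = pluecker a b.
  by apply/rowP=> k; rewrite !mxE enum_rankK def_rep.
have uvab : (col_mx u v <= col_mx a b)%MS.
  apply/rV_subP=> w; rewrite def_S in def_S'.
  by move/setP/(_ w): def_S'; rewrite !inE => ->.
move: (uvab); rewrite col_mx_sub => /andP[uab vab].
have [t def_uv] := pluecker_sub uab vab; exists t => //.
apply: contraTneq free_uv => t0; rewrite -pluecker_eq0 def_uv t0 scale0r.
by rewrite eqxx.
Qed.

Lemma col_generatorP j : exists u v, [/\ row_free (col_mx u v),
  val (enum_val j) = span2 u v & (col j generator)^T = pluecker u v].
Proof.
have [a [b [rk [def_S def_rep]]]] := repP (enum_val j).
exists a, b; split=> //; first exact/eqP.
by apply/rowP=> k; rewrite !mxE def_rep.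
Qed.

Definition coord_form (w : wedge F m (m - 2)) : 'rV[F]_N :=
  \row_k \sum_(B : rsets m (m - 2)%N | [disjoint pairset k & val B])
    wsign (pairset k) (val B) F * w B.

Lemma tauE w : tau rep w = coord_form w *m generator.
Proof.
apply/rowP=> j; rewrite !mxE /wedge_top.
rewrite (reindex (fun k : 'I_N => enum_val k)) /=; last first.
  by exists enum_rank => A _; rewrite ?enum_valK ?enum_rankK.
apply: eq_bigr => k _; rewrite !mxE mulr_suml; apply: eq_bigr => B _.
by rewrite mulrAC.
Qed.

(** Hodge duality: the only [(m - 2)]-set disjoint from a pair is its complement, and the sign is
    its own inverse. *)
Lemma coord_form_surj c : exists w, coord_form w = c.
Proof.
have card_compl (B : rsets m (m - 2)%N) : #|~: val B| == 2.
  have /eqP cB := valP B; rewrite cardsCs setCK cB card_ord; lia.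
pose cmpl B : rsets m 2 := exist _ (~: val B) (card_compl B).
exists [ffun B => wsign (~: val B) (val B) F * c 0 (enum_rank (cmpl B))].
apply/rowP=> k; rewrite mxE.
have cardB : #|~: pairset k| == (m - 2)%N.
  by rewrite cardsCs setCK card_ord (eqP (valP (enum_val k))).
pose Bk : rsets m (m - 2)%N := exist _ (~: pairset k) cardB.
rewrite (big_pred1 Bk) => [|B]; last first.
  rewrite disjoints_subset /= -val_eqE /= eqEcard.
  rewrite (eqP cardB) (eqP (valP B)) leqnn andbT.
  by rewrite -setCS setCK.
rewrite ffunE /= setCK mulrA -expr2 sqrr_sign mul1r; congr (c 0 _).
by rewrite -[RHS]enum_valK; congr enum_rank; apply: val_inj; rewrite /= setCK.
Qed.

Lemma eqmx_grassmann_code : (grassmann_code rep :=: generator)%MS.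
Proof.
apply/eqmxP/andP; split.
  by apply/sumsmx_subP=> w _; rewrite genmxE tauE submxMl.
apply/row_subP=> k; have [w def_w] := coord_form_surj (delta_mx 0 k).
by rewrite rowE -def_w -tauE (sumsmx_sup w) // genmxE.
Qed.

(** A support element is a plane on which some form of [X] is nonzero, and it is met once per
    ordered basis. Dependent pairs have Plücker vector 0. *)
Lemma card_msupp r (X : 'M[F]_(r, N)) :
  (#|msupp (X *m generator)| * gl2_order F = form_count X)%N.
Proof.
have -> : #|msupp (X *m generator)| =
    #|[set S | enum_rank S \in msupp (X *m generator)]|.
  rewrite -[RHS](card_imset _ enum_rank_inj); apply: eq_card => j.
  apply/idP/imsetP=> [jX|[S + ->]]; last by rewrite inE.
  by exists (enum_val j); rewrite ?in_set1 ?enum_valK // in_set enum_valK.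
rewrite -(card_planes (P := fun z => X *m (pluecker z.1 z.2)^T != 0)).
  apply: eq_card => z; rewrite !inE; have [//|] := boolP (row_free _).
  by rewrite -pluecker_eq0 => /eqP->; rewrite trmx0 mulmx0 eqxx.
move=> S u v free_uv def_S /=; have [t t0 ->] := col_generator free_uv def_S.
rewrite inE linearZ /= trmxK -scalemxAr scaler_eq0 (negbTE t0) /=.
by rewrite [in RHS]colE -mulmxA -colE.
Qed.

Lemma card_planes_all : (n * gl2_order F = (q ^ m - 1) * (q ^ m - q))%N.
Proof.
have := card_free_pairs (1%:M : 'M[F]_m); rewrite mxrank1 => <-.
rewrite -cardsT -(card_planes (P := xpredT)) //.
by apply: eq_card => z; rewrite !inE !submx1 andbT.
Qed.

Lemma row_free_generator : row_free generator.
Proof.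
apply: inj_row_free => c cG; have := card_msupp c.
rewrite cG form_countE; have -> : msupp (0 : 'M[F]_(1, n)) = set0.
  by apply/setP=> j; rewrite !inE col0 eqxx.
rewrite cards0 mul0n => /esym/eqP; rewrite muln_eq0 !subn_eq0.
rewrite !leq_exp2l ?q_gt1 // => /orP[|]; last lia.
move=> le_m; apply: (@alt_inj F m); rewrite linear0; apply/eqP.
rewrite -mxrank_eq0; lia.
Qed.

Lemma sub_codeP r (D : 'M[F]_(r, n)) : \rank D = r ->
    (D <= grassmann_code rep)%MS ->
  exists2 X : 'M[F]_(r, N), \rank X = r & D = X *m generator.
Proof.
move=> rkD; rewrite eqmx_grassmann_code => /submxP[X def_D]; exists X => //.
by rewrite -[RHS]rkD def_D mxrankMfree ?row_free_generator.
Qed.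

Lemma higher_weightP r d :
    (exists2 X : 'M[F]_(r, N), \rank X = r & #|msupp (X *m generator)| = d) ->
    (forall X : 'M[F]_(r, N), \rank X = r -> d <= #|msupp (X *m generator)|)%N ->
  is_higher_weight (grassmann_code rep) r d.
Proof.
move=> [X rkX wX] le_d; split.
  exists (X *m generator); split=> //.
    by rewrite mxrankMfree ?row_free_generator.
  by rewrite eqmx_grassmann_code submxMl.
by move=> D rkD /(sub_codeP rkD)[Y rkY ->]; apply: le_d.
Qed.

(** Each coordinate off the support contributes the [q - 1] nonzero multiples of its representative,
    and the final 1 is the zero vector. *)
Lemma card_decomposable_ker r (X : 'M[F]_(r, N)) :
  #|[set c in rowg (kermx X^T) | decomposable c]| =
  (#|~: msupp (X *m generator)| * (q - 1) + 1)%N.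
Proof.
set D := [set c in _ | _].
have D0 : 0 \in D.
  rewrite !inE sub0mx; apply/decomposableP.
  by exists 0, 0; rewrite plueckerxx.
rewrite (cardsD1 0) D0 addnC; congr (_ + _)%N.
pose f (z : 'I_n * F) := z.2 *: (col z.1 generator)^T.
have f_inj : {in setX setT [set~ 0] &, injective f}.
  move=> [i s] [j t]; rewrite !inE /= => s0 t0; rewrite /f /=.
  have [a [b [free_ab def_i def_ab]]] := col_generatorP i.
  have [u [v [free_uv def_j def_uv]]] := col_generatorP j => eq_f.
  have eq_ij : i = j.
    apply: enum_val_inj; apply: val_inj; rewrite def_i def_j.
    apply/setP=> w; rewrite !inE -(eqmx_alt_pluecker free_ab).
    rewrite -(eqmx_alt_pluecker free_uv) -(eqmx_scale (alt _) s0).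
    rewrite -(eqmx_scale (alt (pluecker u v)) t0).
    by rewrite -[s *: _]linearZ -[t *: _]linearZ -def_ab -def_uv /= eq_f.
  congr (_, _) => //; move: eq_f; rewrite eq_ij def_uv => /eqP.
  rewrite -subr_eq0 -scalerBl scaler_eq0 pluecker_eq0 free_uv orbF.
  by rewrite subr_eq0 => /eqP.
transitivity #|f @: setX (~: msupp (X *m generator)) [set~ 0]|; last first.
  rewrite card_in_imset ?cardsX ?cardsC1 ?subn1 // => [[i s] [j t]].
  rewrite !in_setX => /andP[_ s0] /andP[_ t0]; apply: f_inj.
    by rewrite in_setX in_setT.
  by rewrite in_setX in_setT.
have ker_col j : (col j (X *m generator) == 0) =
    ((col j generator)^T <= kermx X^T)%MS.
  by rewrite sub_kermx -trmx_mul trmx_eq0 colE -mulmxA -colE.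
apply: eq_card => c; rewrite in_setD1 [c \in D]inE mem_rowg.
apply/and3P/imsetP=> [[c0 cX /decomposableP[u [v def_c]]]|[[j t]]]; last first.
  rewrite in_setX !inE negbK /= ker_col => /andP[jX t0] ->.
  rewrite /f /= scalemx_sub //; have [a [b [free_ab _ ->]]] := col_generatorP j.
  rewrite scaler_eq0 (negbTE t0) pluecker_eq0 free_ab; split=> //.
  by apply/decomposableP; rewrite -plueckerZl; eexists; eexists.
have free_uv : row_free (col_mx u v).
  by rewrite -[row_free _]negbK -pluecker_eq0 -def_c.
pose S : Gr2 F m := Sub (span2 u v) (is_plane_span2 free_uv).
have [t t0 def_uv] := @col_generator S u v free_uv erefl.
exists (enum_rank S, t); last by rewrite def_c.
rewrite in_setX !inE negbK t0 andbT /= ker_col.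
by rewrite -(eqmx_scale _ t0) -def_uv -def_c.
Qed.

End GrassmannCode.

(** * Weights of spaces of forms of dimension [m] *)

Section FormWeights.

Variables (F : finFieldType) (m : nat).
Hypothesis m_gt4 : (4 < m)%N.
Notation N := #|{: rsets m 2}|.
Notation q := #|F|.

(** Because [X] has exactly [m] rows, the multiplicity in [form_count_sum] equals the second factor
    in [form_countE], and the two cancel. *)
Lemma form_count_rowg (X : 'M[F]_(m, N)) : row_free X ->
  form_count X = (\sum_(c in rowg X) (q ^ m - q ^ (m - \rank (alt c))))%N.
Proof.
move=> freeX; have pos : (0 < q ^ m - q ^ (m - 1))%N.
  by rewrite subn_gt0 ltn_exp2l ?q_gt1 //; lia.
apply/eqP; rewrite -(eqn_pmul2r pos) form_count_sum big_distrl /=.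
have -> : rowg X = [set y *m X | y in [set: 'rV[F]_m]].
  apply/setP=> c; rewrite mem_rowg; apply/submxP/imsetP=> [[y ->]|[y _ ->]].
    by exists y.
  by exists y.
rewrite big_imset /=; last by move=> y z _ _; apply: row_free_inj.
apply/eqP; apply: eq_big => [y|y _]; first by rewrite inE.
exact: form_countE.
Qed.

(** The corrections raise ranks 0 and 2 to the value [q ^ m - q ^ (m - 4)] of rank 4. The zero
    vector, itself decomposable, receives both. *)
Definition rank_defect (c : 'rV[F]_N) : nat :=
  (q ^ m - q ^ (m - \rank (alt c)) +
    decomposable c * (q ^ (m - 2) - q ^ (m - 4)) +
    (c == 0%R) * (q ^ m - q ^ (m - 2)))%N.

Lemma rank_defect_ge c : (q ^ m - q ^ (m - 4) <= rank_defect c)%N.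
Proof.
have le42 : (q ^ (m - 4) <= q ^ (m - 2))%N.
  by rewrite leq_exp2l ?q_gt1 //; lia.
have le2 : (q ^ (m - 2) <= q ^ m)%N by rewrite leq_exp2l ?q_gt1 //; lia.
rewrite /rank_defect.
have [/decomposableP[u [v ->]]|] := boolP (decomposable c).
  rewrite pluecker_eq0; have [free_uv|_] := boolP (row_free _); last lia.
  by rewrite rank_alt_pluecker //; lia.
move/rank_alt_indecomposable=> rk4.
have : (q ^ (m - \rank (alt c)) <= q ^ (m - 4))%N.
  by rewrite leq_exp2l ?q_gt1 //; lia.
lia.
Qed.

Lemma rank_defect_eq c :
  (\rank (alt c) <= 4)%N -> rank_defect c = (q ^ m - q ^ (m - 4))%N.
Proof.
have le42 : (q ^ (m - 4) <= q ^ (m - 2))%N.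
  by rewrite leq_exp2l ?q_gt1 //; lia.
have le2 : (q ^ (m - 2) <= q ^ m)%N by rewrite leq_exp2l ?q_gt1 //; lia.
rewrite /rank_defect.
have [/decomposableP[u [v ->]] _|] := boolP (decomposable c).
  rewrite pluecker_eq0; have [free_uv|] := boolP (row_free _).
    by rewrite rank_alt_pluecker //; lia.
  by rewrite -pluecker_eq0 => /eqP->; rewrite linear0 mxrank0 subn0; lia.
move=> indec le4; have rk4 := rank_alt_indecomposable indec.
have -> : \rank (alt c) = 4 by apply/eqP; rewrite eqn_leq le4.
rewrite mul0n addn0; case: eqP => [c0|_]; last by rewrite addn0.
by move: rk4; rewrite c0 linear0 mxrank0.
Qed.

Lemma sum_rank_defect (X : 'M[F]_(m, N)) : row_free X ->
  (\sum_(c in rowg X) rank_defect c =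
   form_count X + #|[set c in rowg X | decomposable c]| *
     (q ^ (m - 2) - q ^ (m - 4)) + (q ^ m - q ^ (m - 2)))%N.
Proof.
move=> freeX; rewrite !big_split /= -form_count_rowg //; congr (_ + _ + _)%N.
  rewrite -big_distrl /=; congr (_ * _)%N; rewrite -[RHS]sum1_card.
  rewrite big_mkcond [RHS]big_mkcond; apply: eq_bigr => c _.
  by rewrite !inE; case: (c <= X)%MS => //=; case: decomposable.
rewrite (bigD1 0%R) ?mem_rowg ?sub0mx //= eqxx mul1n big1 ?addn0 // => c.
by case/andP=> _ /negbTE->.
Qed.

Lemma form_count_ge (X : 'M[F]_(m, N)) : row_free X ->
  (q ^ m * (q ^ m - q ^ (m - 4)) <=
   form_count X + #|[set c in rowg X | decomposable c]| *
     (q ^ (m - 2) - q ^ (m - 4)) + (q ^ m - q ^ (m - 2)))%N.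
Proof.
move=> freeX; rewrite -sum_rank_defect // -{1}(eqP freeX) -card_rowg.
rewrite -sum_nat_const.
by apply: leq_sum => c _; apply: rank_defect_ge.
Qed.

Lemma form_count_eq (X : 'M[F]_(m, N)) : row_free X ->
    (forall c : 'rV[F]_N, (c <= X)%MS -> (\rank (alt c) <= 4)%N) ->
  (q ^ m * (q ^ m - q ^ (m - 4)) =
   form_count X + #|[set c in rowg X | decomposable c]| *
     (q ^ (m - 2) - q ^ (m - 4)) + (q ^ m - q ^ (m - 2)))%N.
Proof.
move=> freeX rk4; rewrite -sum_rank_defect // -{1}(eqP freeX) -card_rowg.
rewrite -sum_nat_const.
by apply: eq_bigr => c; rewrite mem_rowg => /rk4/rank_defect_eq.
Qed.

End FormWeights.

(** * Geometric sums and the numerical identity for the second weight *)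

Lemma geometric_sum q k : (0 < q)%N ->
  ((\sum_(i < k) q ^ i) * (q - 1) + 1 = q ^ k)%N.
Proof.
move=> q0; elim: k => [|k IHk]; first by rewrite big_ord0.
rewrite big_ord_recr /= mulnDl addnAC IHk expnS.
by case: q q0 {IHk} => // p _; rewrite subn1 /= mulnC -mulSn mulnC.
Qed.

Lemma geometric_sum_rev q k d : (0 < q)%N -> (k <= d.+1)%N ->
  ((\sum_(j < k) q ^ (d - j)) * (q - 1) + q ^ (d.+1 - k) = q ^ d.+1)%N.
Proof.
move=> q0; elim: k => [|k IHk] lekd; first by rewrite big_ord0.
rewrite -[RHS]IHk; last exact: ltnW.
rewrite big_ord_recr /= mulnDl -addnA subSS; congr addn.
have -> : (d.+1 - k)%N = (d - k).+1 by lia.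
by rewrite expnS; case: q q0 {IHk} => // p _; rewrite subn1 /= mulnC -mulSnr.
Qed.

Definition dual_weight q m : nat :=
  (\sum_(j < m - 1) q ^ (2 * (m - 2) - j) + q ^ (2 * (m - 2) - 2))%N.

(** For the extremal number [D] of decomposable vectors, the balance in [form_count_eq] is met by
    [dual_weight] times the order of [GL_2]. *)
Lemma dual_weight_eq q m D : (1 < q)%N -> (4 < m)%N ->
    (D + q ^ 2 = q ^ m.-1 + q ^ 3)%N ->
  (q ^ m * (q ^ m - q ^ (m - 4)) =
   dual_weight q m * ((q ^ 2 - 1) * (q ^ 2 - q)) +
     D * (q ^ (m - 2) - q ^ (m - 4)) + (q ^ m - q ^ (m - 2)))%N.
Proof.
move=> q1 m4 eqD.
have := @geometric_sum_rev q (m - 1) (2 * (m - 2)) (ltnW q1) _.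
rewrite /dual_weight; move: (\sum_(j < m - 1) _)%N => S.
have [k def_m] : exists k, m = (k + 4)%N by exists (m - 4)%N; lia.
have -> : ((2 * (m - 2)).+1 - (m - 1) = k + 2)%N by lia.
have -> : ((2 * (m - 2)).+1 = k + k + 5)%N by lia.
have -> : (2 * (m - 2) - 2 = k + k + 2)%N by lia.
have -> : (m - 2 = k + 2)%N by lia.
have -> : (m - 4 = k)%N by lia.
move: eqD; have -> : m.-1 = (k + 3)%N by lia.
rewrite def_m !expnD; move: (q ^ k)%N => P eqD eqS.
have [s def_q] : exists s, q = s.+1 by exists q.-1; lia.
have {}eqS : (S * s + P * q ^ 2 = P * P * q ^ 5)%N.
  by rewrite -eqS; [rewrite def_q subn1 | lia].
have -> : (P * q ^ 4 - P = P * (q ^ 2 + 1) * (q ^ 2 - 1))%N.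
  rewrite !mulnBr !mulnDr !mulnDl; rewrite !expnS expn0; nia.
have -> : (P * q ^ 4 - P * q ^ 2 = P * q ^ 2 * (q ^ 2 - 1))%N.
  by rewrite mulnBr muln1 -mulnA -expnD.
have -> : (P * q ^ 2 - P = P * (q ^ 2 - 1))%N by rewrite mulnBr muln1.
have -> : (q ^ 2 - q = q * s)%N by rewrite def_q expnS expn1; nia.
(* The identity after the common factor [q ^ 2 - 1] is removed from all terms. *)
have key : (P * q ^ 4 * (P * (q ^ 2 + 1)) =
    (S + P * P * q ^ 2) * (q * s) + D * P + P * q ^ 2)%N.
  have eqSq : (S * s * q + P * q ^ 2 * q = P * P * q ^ 5 * q)%N.
    by rewrite -mulnDl eqS.
  have eqDP : (D * P + q ^ 2 * P = (P * q ^ 3 + q ^ 3) * P)%N.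
    by rewrite -mulnDl eqD.
  move: eqSq eqDP; rewrite !expnS expn0 def_q; nia.
by rewrite mulnA key !mulnDl; move: (q ^ 2 - 1)%N => Q; ring.
Qed.

(** * Existence of the extremal subspace, and the two higher weights *)

Section Extremal.

Variables (F : finFieldType) (m : nat).
Hypothesis m_gt4 : (4 < m)%N.
Notation N := #|{: rsets m 2}|.
Notation q := #|F|.

Lemma ex_extremal : exists E : 'M[F]_N, [/\ \rank E = m,
  (#|[set c in rowg E | decomposable c]| + q ^ 2 = q ^ m.-1 + q ^ 3)%N &
  forall c : 'rV[F]_N, (c <= E)%MS -> (\rank (alt c) <= 4)%N].
Proof.
have m3 : (1 + (1 + 1) <= m)%N by lia.
pose Z : 'M[F]_(1 + (1 + 1), m) := pid_mx (1 + (1 + 1)).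
have freeZ : row_free Z by rewrite /row_free rank_pid_mx.
pose x := usubmx Z; pose a := usubmx (dsubmx Z); pose b := dsubmx (dsubmx Z).
have free_xab : row_free (col_mx x (col_mx a b)) by rewrite !vsubmxK.
have x0 : x != 0.
  apply: contraTneq free_xab => ->; rewrite /row_free -addsmxE adds0mx.
  by rewrite ltn_eqF // ltnS rank_leq_row.
exists (extremal x a b); split; first exact: rank_extremal.
  apply/eqP; rewrite eqn_leq card_decomposable_extremal_ge // andbT.
  by rewrite card_decomposable_le ?rank_extremal.
by move=> c; apply: rank_alt_extremal.
Qed.

Lemma ex_row_free_base p (A : 'M[F]_(p, N)) r : \rank A = r ->
  exists2 X : 'M[F]_(r, N), row_free X & (X :=: A)%MS.
Proof.
move=> <-; exists (row_base A); first exact: row_base_free.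
exact: eq_row_base.
Qed.

End Extremal.

Lemma gauss_binom_planes (F : finFieldType) (m : nat) :
  gauss_binom #|F| m 2 = #|{: Gr2 F m}|%:R :> rat.
Proof.
have q1 := q_gt1 F; have := card_planes_all F m.
rewrite /gauss_binom !big_ord_recl big_ord0 /= mulr1 expn0 expn1.
move/(congr1 (fun k => k%:R : rat)); rewrite /gl2_order !natrM => eq_n.
have A0 : (#|F| ^ 2 - 1)%:R != 0 :> rat.
  by rewrite Num.Theory.pnatr_eq0 subn_eq0 -ltnNge -(expn0 #|F|) ltn_exp2l.
have B0 : (#|F| ^ 2 - #|F|)%:R != 0 :> rat.
  by rewrite Num.Theory.pnatr_eq0 subn_eq0 -ltnNge -{1}(expn1 #|F|) ltn_exp2l.
by rewrite mulf_div -eq_n mulfK // mulf_neq0.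
Qed.

Theorem theorem6p8 (F : finFieldType) (m : nat) (rep : Gr2 F m -> wedge F m 2) :
  (4 < m)%N -> good_reps rep ->
  let q := #|F| in
  let k := 'C(m, 2) in
  let delta := (2 * (m - 2))%N in
  let mu := (m - 1)%N in
  (exists d : nat,
     is_higher_weight (grassmann_code rep) (k - mu - 1) d /\
     (d%:R : rat) = gauss_binom q m 2 - ((\sum_(i < mu) q ^ i + q ^ 2)%N)%:R)
  /\
  is_higher_weight (grassmann_code rep) (mu + 1)
    (\sum_(j < mu) q ^ (delta - j) + q ^ (delta - 2))%N.
Proof.
move=> m4 repP q k delta mu.
have q1 : (1 < q)%N := q_gt1 F.
have [E [rkE cardE rk4E]] := @ex_extremal F m m4.
split; last first.
  have -> : (mu + 1 = m)%N by rewrite /mu; lia.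
  have gl0 := gl2_order_gt0 F.
  have weq := dual_weight_eq q1 m4 cardE; rewrite -/(gl2_order F) in weq.
  apply: (higher_weightP m4 repP).
    have [X freeX eqXE] := ex_row_free_base rkE; exists X; first exact/eqP.
    apply/eqP; rewrite -(eqn_pmul2r gl0) (card_msupp repP).
    have := form_count_eq m4 freeX; rewrite (eq_rowg eqXE) weq.
    have rk4X (c : 'rV[F]__) : (c <= X)%MS -> (\rank (alt c) <= 4)%N.
      by rewrite eqXE; apply: rk4E.
    by move=> /(_ rk4X)/eqP; rewrite !eqn_add2r eq_sym.
  (* [E] has the most decomposable vectors, so its correction term is the largest and the remaining
     form count the smallest. *)
  move=> X rkX; rewrite -(leq_pmul2r gl0) (card_msupp repP).
  have := form_count_ge m4 (introT eqP rkX); have := card_decomposable_le rkX.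
  rewrite weq -cardE leq_add2r => le_D; rewrite leq_add2r => le_w.
  rewrite -(leq_add2r (#|[set c in rowg E | decomposable c]| *
     (q ^ (m - 2) - q ^ (m - 4)))); apply: leq_trans le_w _.
  by rewrite leq_add2l leq_mul2r le_D orbT.
have kE : #|{: rsets m 2}| = k by apply: card_rsets.
have le_mk : (m <= k)%N by have := rank_leq_row E; rewrite rkE kE.
pose d0 := (\sum_(i < mu) q ^ i + q ^ 2)%N.
(* Hence [d0] is the number of points of the Grassmannian on [E]: its nonzero decomposable vectors
   up to scalars. *)
have d0E : (d0 * (q - 1) + 1 + q ^ 2 = q ^ m.-1 + q ^ 3)%N.
  have := geometric_sum mu (ltnW q1); rewrite /d0 /mu subn1 => <-.
  rewrite mulnDl !expnS expn0.
  have [p ->] : exists p, q = p.+1 by exists q.-1; lia.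
  by rewrite subn1 /=; nia.
pose supp r (X : 'M[F]_(r, _)) := msupp (X *m generator rep).
have cardC r (X : 'M[F]_(r, _)) :
    (#|supp r X| + #|~: supp r X| = #|{: Gr2 F m}|)%N.
  by rewrite cardsC card_ord.
have rk_ker (X : 'M[F]_(k - m, #|{: rsets m 2}|)) :
    \rank X = (k - m)%N -> \rank (kermx X^T) = m.
  by move=> rkX; rewrite mxrank_ker mxrank_tr rkX kE subKn.
have -> : (k - mu - 1 = k - m)%N by rewrite /mu; lia.
(* [X] is a basis of the annihilator of [E]. By dimension, the annihilator of [X] is [E] again, so
   the zero coordinates are the points on [E]. *)
have [X rkX suppX] : exists2 X : 'M[F]_(k - m, #|{: rsets m 2}|),
    \rank X = (k - m)%N & #|~: supp _ X| = d0.
  have rkK : \rank (kermx E^T) = (k - m)%N.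
    by rewrite mxrank_ker mxrank_tr rkE kE.
  have [X freeX eqXK] := ex_row_free_base rkK; exists X; first exact/eqP.
  have EX : (E <= kermx X^T)%MS.
    apply/sub_kermxP; rewrite -[E]trmxK -trmx_mul.
    by have /sub_kermxP -> : (X <= kermx E^T)%MS; rewrite ?eqXK ?trmx0.
  have eqEX : (E :=: kermx X^T)%MS.
    apply/eqmxP; rewrite -(geq_leqif (mxrank_leqif_eq EX)) rk_ker ?rkE //.
    exact/eqP.
  move: cardE; rewrite (eq_rowg eqEX) (card_decomposable_ker repP) -d0E => /eqP.
  by rewrite !eqn_add2r eqn_pmul2r ?subn_gt0 // => /eqP.
have le_n : (d0 <= #|{: Gr2 F m}|)%N.
  by have := cardC _ X; rewrite suppX => <-; rewrite leq_addl.
exists (#|{: Gr2 F m}| - d0)%N; split; last first.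
  by rewrite gauss_binom_planes natrB.
apply: (higher_weightP m4 repP).
  exists X => //; apply/eqP; rewrite -(eqn_add2r d0) subnK //; apply/eqP.
  by have := cardC _ X; rewrite suppX.
move=> Y rkY; rewrite leq_subLR.
apply: leq_trans (eq_leq (esym (cardC _ Y))) _; rewrite addnC leq_add2r.
have := card_decomposable_le (rk_ker Y rkY).
rewrite (card_decomposable_ker repP) -d0E !leq_add2r.
by rewrite leq_pmul2r ?subn_gt0.
Qed.
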